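(* Let $\mathcal G$ be a locally finite $\Gamma$-periodic graph with fundamental graph $\mathcal G_*=(\mathcal V_*,\mathcal A_* )$, $\nu=\#\mathcal V_*$, let $V$ be a real $\Gamma$-periodic potential, let $H=A-\varkappa+V$ be the Schrödinger operator on $\ell^2(\mathcal V)$ and let $H(k)=A(k)-\varkappa+V$, $k\in\mathbb T^d$, be the fiber Schrödinger operator on $\ell^2(\mathcal V_* )$. Then the trace of the resolvent of $H(k)$ has the following expansions: $$(1)\quad \operatorname{Tr}\big(H(k)-\lambda I\big)^{-1}=-\frac\nu\lambda-\sum_{n=1}^\infty\frac{\mathcal T_n(k)}{\lambda^{n+1}}=-\frac\nu\lambda-\sum_{\mathbf c\in\widetilde{\mathcal C}}\frac{\omega(\mathbf c)}{\lambda^{|\mathbf c|+1}}e^{-i\langle\tau(\mathbf c),k\rangle}=-\frac\nu\lambda-\sum_{\mathbf c\in\widetilde{\mathcal C}}\frac{\omega(\mathbf c)}{\lambda^{|\mathbf c|+1}}\cos\langle\tau(\mathbf c),k\rangle,$$ $$(2)\quad \operatorname{Tr}\big(H(k)-\lambda I\big)^{-1}=-\frac\nu\lambda-\sum_{\mathrm m\in\mathbb Z^d}\mathcal R_{\mathrm m}(\lambda)\cos\langle\mathrm m,k\rangle,\qquad \mathcal R_{\mathrm m}(\lambda)=\sum_{\mathbf c\in\widetilde{\mathcal C}^{\mathrm m}}\frac{\omega(\mathbf c)}{\lambda^{|\mathbf c|+1}},$$ $$(3)\quad \frac1{(2\pi)^d}\int_{\mathbb T^d}\operatorname{Tr}\big(H(k)-\lambda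 I\big)^{-1}dk=-\frac\nu\lambda-\sum_{n=1}^\infty\frac{\mathcal T_{n,0}}{\lambda^{n+1}}=-\frac\nu\lambda-\sum_{\mathbf c\in\widetilde{\mathcal C}^0}\frac{\omega(\mathbf c)}{\lambda^{|\mathbf c|+1}},$$ where $\mathcal T_n(k)=\sum_{\mathbf c\in\widetilde{\mathcal C}_n}\omega(\mathbf c)\cos\langle\tau(\mathbf c),k\rangle$ and $\mathcal T_{n,0}=\sum_{\mathbf c\in\widetilde{\mathcal C}_n^0}\omega(\mathbf c)$. The series in (1), (2) converge absolutely for $|\lambda|>\|H(k)\|$, and the series in (3) converges absolutely for $|\lambda|>\|H\|$.
   Context: Periodic graph. $\mathcal G=(\mathcal V,\mathcal E)$ is a connected infinite graph, possibly having loops and multiple edges, embedded into $\mathbb R^d$; $\mathcal V$ is its vertex set, $\mathcal E$ its set of unoriented edges. Each edge in $\mathcal E$ has two orientations, and $\mathcal A$ is the set of all oriented edges. An oriented edge starting at $x$ and ending at $y$ is denoted $(x,y)$ (several edges may have the same end points). The degree $\varkappa_x$ is the number of edges of $\mathcal A$ starting at $x$. $\Gamma\subset\mathbb R^d$ is a lattice of rank $d$ with basis $a_1,\dots,a_d$. The graph is locally finite and $\Gamma$-periodic: $\mathcal G+a=\mathcal G$ for all $a\in\Gamma$, and the quotient (fundamental) graph $\mathcal G_*=\mathcal G/\Gamma=(\mathcal V_*,\mathcal A_* )$ with $\mathcal V_*=\mathcal V/\Gamma$, $\mathcal A_*=\mathcal A/\Gamma$ is finite. Edge index. Let $\Omega=\{\sum_s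 t_sa_s:\ t_s\in[0,1)\}$. Each $x\in\mathcal V$ is uniquely $x=x_0+[x]$ with $x_0\in\Omega$, $[x]\in\Gamma$; $[x]_{\mathbb A}\in\mathbb Z^d$ is the coordinate vector of $[x]$ in the basis $a_1,\dots,a_d$. For $\mathbf e=(x,y)\in\mathcal A$ put $\tau(\mathbf e)=[y]_{\mathbb A}-[x]_{\mathbb A}\in\mathbb Z^d$. This is $\Gamma$-invariant, so it induces the index $\tau(\mathbf e)$ for $\mathbf e\in\mathcal A_*$. Operators. $V$ is a real function on $\mathcal V$ with $V_{x+a}=V_x$ for $a\in\Gamma$; $V$ and $\varkappa$ are regarded as multiplication operators, also on $\mathcal V_*$. On $\ell^2(\mathcal V)$: $(Af)_x=\sum_{(x,y)\in\mathcal A}f_y$ and $H=A-\varkappa+V$ (bounded self-adjoint). With $\mathbb T^d=\mathbb R^d/(2\pi\mathbb Z)^d$: $(A(k)f)_x=\sum_{\mathbf e=(x,y)\in\mathcal A_*}e^{i\langle\tau(\mathbf e),k\rangle}f_y$ and $H(k)=A(k)-\varkappa+V$ on $\ell^2(\mathcal V_* )=\mathbb C^\nu$. $\|\cdot\|$ of an operator is the operator norm; $I$ is the identity. Modified graph and cycles. $\widetilde{\mathcal G}_*=(\mathcal V_*,\widetilde{\mathcal A}_* )$ is obtained by adding at each $x\in\mathcal V_*$ one loop $\mathbf e_x$ (a single element of $\widetilde{\mathcal A}_*$, its own inverse): $\widetilde{\mathcal A}_*=\mathcal A_*\cup\{\mathbf e_x\}_{x\in\mathcal V_*}$, $\tau(\mathbf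 e_x)=0$. A cycle of length $|\mathbf c|=n\geq1$ is a sequence $\mathbf c=(\mathbf e_1,\dots,\mathbf e_n)$ of oriented edges $\mathbf e_j=(x_j,x_{j+1})$, $x_{n+1}=x_1$ (a closed walk; the starting point and direction matter, and backtracking is allowed); its index is $\tau(\mathbf c)=\sum_j\tau(\mathbf e_j)$. $\widetilde{\mathcal C}$ is the set of all cycles in $\widetilde{\mathcal G}_*$; $\widetilde{\mathcal C}_n$ those of length $n$; $\widetilde{\mathcal C}^{\mathrm m}$ those of index $\mathrm m\in\mathbb Z^d$; $\widetilde{\mathcal C}_n^{\mathrm m}=\widetilde{\mathcal C}_n\cap\widetilde{\mathcal C}^{\mathrm m}$. Edge weights: $\omega(\mathbf e)=1$ for $\mathbf e\in\mathcal A_*$, $\omega(\mathbf e_x)=V_x-\varkappa_x$; $\omega(\mathbf c)=\omega(\mathbf e_1)\cdots\omega(\mathbf e_n)$.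
   Formalization: Sums over cycles are taken as series over the length n of finite sums, and absolute convergence refers to these series; (2) is stated for |λ|>‖H(k')‖ for all k' in the torus, since the literal convergence claims fail (e.g. for Z with V=0, k=0, λ=1). *)

(* Defs.v *)
From HB Require Import structures.
From mathcomp Require Import all_boot all_order all_algebra.
From mathcomp Require Import finmap.
From mathcomp Require Import all_classical all_reals all_analysis.
From mathcomp Require Import complex.
From mathcomp Require Import showcase.summability.

Set Implicit Arguments.
Unset Strict Implicit.
Unset Printing Implicit Defensive.
Import Order.TTheory GRing.Theory Num.Theory numFieldNormedType.Exports.

Local Open Scope classical_set_scope.
Local Open Scope ring_scope.

(* Stating the type of complex numbers as a [numClosedFieldType], and not as
   the bare [R[i]], gives it the norm topology of a [numFieldType]. *)
Definition Cx (R : realType) : numClosedFieldType := R[i].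

Section complex_numbers.
Variable R : realType.

Definition toC (x : R) : Cx R := real_complex R x.

(* The real-valued modulus; [`|z|] would be an element of [Cx R]. *)
Definition cabs (z : Cx R) : R := ComplexField.Normc.normc (z : R[i]).

(* exp (i t) *)
Definition expi (t : R) : Cx R := Complex (cos t) (sin t).

Definition csum1 (u : nat -> Cx R) : Cx R := \big[+%R/0]_(1 <= n <oo) u n.

Definition abs_cvg1 (u : nat -> Cx R) : Prop :=
  cvgn (fun N => \sum_(1 <= n < N) cabs (u n)).

Definition csum (I : choiceType) (F : I -> Cx R) : Cx R :=
  lim (partial_sum F @ totally).

Definition abs_summable (I : choiceType) (F : I -> Cx R) : Prop :=
  (\esum_(i in [set: I]) (cabs (F i))%:E < +oo)%E.

End complex_numbers.

Section lebesgue_cons.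
Context (R : realType) (d : nat).
Variable mu : {sigma_finite_measure set (d.-tuple (measurableTypeR R)) -> \bar R}.

Definition cons_tuple (p : measurableTypeR R * d.-tuple (measurableTypeR R)) : d.+1.-tuple (measurableTypeR R) :=
  [tuple of p.1 :: p.2].

Lemma measurable_cons_tuple : measurable_fun [set: measurableTypeR R * d.-tuple (measurableTypeR R)] cons_tuple.
Proof. exact: measurable_cons. Qed.

Definition lebesgue_cons : set (d.+1.-tuple (measurableTypeR R)) -> \bar R :=
  pushforward (lebesgue_measure \x mu)%E cons_tuple.

Let lebesgue_cons0 : lebesgue_cons set0 = 0%E.
Proof. by rewrite /lebesgue_cons /pushforward preimage_set0 measure0. Qed.

Let lebesgue_cons_ge0 A : (0 <= lebesgue_cons A)%E.
Proof. by rewrite /lebesgue_cons /pushforward; exact: measure_ge0. Qed.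

Let lebesgue_cons_sigma_additive : semi_sigma_additive lebesgue_cons.
Proof.
move=> F mF tF mUF; rewrite /lebesgue_cons /pushforward preimage_bigcup.
apply: measure_semi_sigma_additive.
- by move=> n; rewrite -[X in measurable X]setTI; exact: measurable_cons_tuple.
- apply/trivIsetP => /= i j _ _ ij; rewrite -preimage_setI.
  by move/trivIsetP : tF => /(_ _ _ _ _ ij) ->//; rewrite preimage_set0.
- rewrite -preimage_bigcup -[X in measurable X]setTI.
  exact: measurable_cons_tuple.
Qed.

HB.instance Definition _ := isMeasure.Build _ _ _ lebesgue_cons
  lebesgue_cons0 lebesgue_cons_ge0 lebesgue_cons_sigma_additive.

Let uncons_tuple (t : d.+1.-tuple (measurableTypeR R)) : measurableTypeR R * d.-tuple (measurableTypeR R) :=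
  (tnth t ord0, [tuple of behead t]).

Let lebesgue_cons_sigma_finite : sigma_finite setT lebesgue_cons.
Proof.
have /sigma_finiteP[F [TF ndF Foo]] :=
  sigma_finiteT (@lebesgue_measure R : {sigma_finite_measure set _ -> \bar R}).
have /sigma_finiteP[H [TH ndH Hoo]] := sigma_finiteT mu.
have cU t : uncons_tuple (cons_tuple t) = t.
  by case: t => x t; congr pair; apply: val_inj.
have mU : measurable_fun setT uncons_tuple.
  apply/measurable_fun_pairP; split; first exact: measurable_tnth.
  exact: measurable_behead.
exists (fun n => uncons_tuple @^-1` (F n `*` H n)).
  apply/esym; rewrite -subTset => t _.
  have : [set: measurableTypeR R] (uncons_tuple t).1 by [].
  have : [set: d.-tuple (measurableTypeR R)] (uncons_tuple t).2 by [].
  rewrite TF TH => -[k _ Hk] [n _ Fn]; exists (maxn n k) => //; split.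
    by move: Fn; exact/subsetPset/ndF/leq_maxl.
  by move: Hk; exact/subsetPset/ndH/leq_maxr.
move=> n; have [mF F_lt] := Foo n; have [mH H_lt] := Hoo n; split.
  by rewrite -[X in measurable X]setTI; apply: mU => //; exact: measurableX.
rewrite /lebesgue_cons /pushforward -comp_preimage.
rewrite (_ : uncons_tuple \o cons_tuple = id); last exact/funext.
by rewrite preimage_id product_measure1E// lte_mul_pinfty// ge0_fin_numE.
Qed.

HB.instance Definition _ := Measure_isSigmaFinite.Build _ _ _ lebesgue_cons
  lebesgue_cons_sigma_finite.

End lebesgue_cons.

Fixpoint lebesgue_tuple (R : realType) (d : nat) :
    {sigma_finite_measure set (d.-tuple (measurableTypeR R)) -> \bar R} :=
  match d with
  | 0 => \d_([tuple])
  | d'.+1 => lebesgue_cons (lebesgue_tuple R d')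
  end.

Section torus.
Context (R : realType) (d : nat).

Definition torus_box : set (d.-tuple (measurableTypeR R)) :=
  [set t | forall i, 0 <= tnth t i < 2 * pi].

(* Integral over (R/2piZ)^d of a 2pi-periodic function f on R^d. *)
Definition torus_int (f : 'rV[R]_d -> Cx R) : Cx R :=
  let g (t : d.-tuple (measurableTypeR R)) : R[i] := f (\row_i tnth t i) in
  Complex (\int[lebesgue_tuple R d]_(t in torus_box) complex.Re (g t))
          (\int[lebesgue_tuple R d]_(t in torus_box) complex.Im (g t)).

Definition pairing (m : 'rV[int]_d) (k : 'rV[R]_d) : R :=
  \sum_i (m 0 i)%:~R * k 0 i.

End torus.

Section operators.
Variable R : realType.

(* The norm of f in l^2(X), equal to +oo when f is not square summable. *)
Definition l2norm (X : choiceType) (f : X -> Cx R) : \bar R :=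
  sqrte (\esum_(x in [set: X]) (cabs (f x) ^+ 2)%:E).

Definition opnorm (X : choiceType) (T : (X -> Cx R) -> (X -> Cx R)) : \bar R :=
  ereal_sup [set l2norm (T f) | f in [set f | (l2norm f <= 1)%E]].

Definition opmx (X : finType) (T : (X -> Cx R) -> (X -> Cx R)) :
    'M[Cx R]_#|X| :=
  \matrix_(i, j) T (fun x => (x == enum_val j)%:R) (enum_val i).

Definition tr_resolvent (X : finType) (T : (X -> Cx R) -> (X -> Cx R))
    (lambda : Cx R) : Cx R :=
  \tr (invmx (opmx T - lambda%:M)).

End operators.

(* [edge] is the set of oriented edges; [erev e] is e with the opposite
   orientation. As every unoriented edge, loops included, has two orientations,
   [erev] has no fixed point. The rows of [basis] are the basis a_1, .., a_d of
   the lattice, whose elements are given by their coordinates in 'rV[int]_d. As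
   the graph may have multiple edges, the translation of edges is not
   determined by that of vertices, and is part of the structure. *)
Record periodic_graph (R : realType) (d : nat) := PeriodicGraph {
  basis : 'M[R]_d;
  vert : choiceType;
  edge : choiceType;
  pos : vert -> 'rV[R]_d;
  orig : edge -> vert;
  term : edge -> vert;
  erev : edge -> edge;
  vshift : 'rV[int]_d -> vert -> vert;
  eshift : 'rV[int]_d -> edge -> edge;
  basis_unit : basis \in unitmx;
  pos_inj : injective pos;
  erevK : involutive erev;
  erev_neq : forall e, erev e != e;
  orig_erev : forall e, orig (erev e) = term e;
  pos_vshift : forall m x,
    pos (vshift m x) = pos x + map_mx (fun z : int => z%:~R) m *m basis;
  eshift0 : forall e, eshift 0 e = e;
  eshiftD : forall m n e, eshift (m + n) e = eshift m (eshift n e);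
  orig_eshift : forall m e, orig (eshift m e) = vshift m (orig e);
  erev_eshift : forall m e, erev (eshift m e) = eshift m (erev e);
  vert_infinite : infinite_set [set: vert];
  connected_graph : forall x y, exists p : seq vert,
    path (fun u v => `[< exists e, orig e = u /\ term e = v >]) x p /\
    last x p = y;
  locally_finite : forall x, finite_set [set e | orig e = x];
  cofinite_vert : finite_set
    (range (fun x => [set y | exists m, y = vshift m x]));
  cofinite_edge : finite_set
    (range (fun e => [set e' | exists m, e' = eshift m e]))
}.

Section graph.
Context (R : realType) (d : nat) (G : periodic_graph R d).

Definition vorbit (x : vert G) : set (vert G) :=
  [set y | exists m, y = vshift m x].
Definition eorbit (e : edge G) : set (edge G) :=
  [set e' | exists m, e' = eshift m e].

Definition qvert : finType := fset_set (range vorbit).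
Definition qedge : finType := fset_set (range eorbit).

Fact vproj_subproof (x : vert G) : vorbit x \in fset_set (range vorbit).
Proof.
by rewrite in_fset_set; [apply/mem_set; exists x|exact: cofinite_vert].
Qed.
Definition vproj (x : vert G) : qvert := FSetSub (vproj_subproof x).

Fact eproj_subproof (e : edge G) : eorbit e \in fset_set (range eorbit).
Proof.
by rewrite in_fset_set; [apply/mem_set; exists e|exact: cofinite_edge].
Qed.
Definition eproj (e : edge G) : qedge := FSetSub (eproj_subproof e).

Lemma vproj_surj (X : qvert) : exists x, vproj x = X.
Proof.
have := fsvalP X; rewrite in_fset_set; last exact: cofinite_vert.
by move=> /set_mem[x _ xX]; exists x; apply: val_inj.
Qed.

Lemma eproj_surj (E : qedge) : exists e, eproj e = E.
Proof.
have := fsvalP E; rewrite in_fset_set; last exact: cofinite_edge.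
by move=> /set_mem[e _ eE]; exists e; apply: val_inj.
Qed.

(* Representatives of the orbits; the data induced on the quotient do not
   depend on their choice. *)
Definition vrep (X : qvert) : vert G := projT1 (cid (vproj_surj X)).
Definition erep (E : qedge) : edge G := projT1 (cid (eproj_surj E)).

Definition qorig (E : qedge) : qvert := vproj (orig (erep E)).
Definition qterm (E : qedge) : qvert := vproj (term (erep E)).

Definition deg (x : vert G) : nat := #|` fset_set [set e | orig e = x]|.
Definition qdeg (X : qvert) : nat := deg (vrep X).

Definition latvec (m : 'rV[int]_d) : 'rV[R]_d :=
  map_mx (fun z : int => z%:~R) m *m basis G.

Definition cell : set 'rV[R]_d :=
  [set v | exists t : 'rV[R]_d,
     (forall s, 0 <= t 0 s < 1) /\ v = t *m basis G].

(* The coordinates of [x]; see [int_partP]. *)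
Definition int_part (x : vert G) : 'rV[int]_d :=
  \row_s Num.floor ((pos x *m invmx (basis G)) 0 s).

Lemma int_partP (x : vert G) (m : 'rV[int]_d) :
  cell (pos x - latvec m) <-> m = int_part x.
Proof.
have bU := basis_unit G; rewrite /cell /latvec /=; split.
  move=> [t [t01 xt]]; apply/rowP => s; rewrite mxE.
  have -> : pos x *m invmx (basis G) = t + map_mx (fun z : int => z%:~R) m.
    apply: (can_inj (mulmxK bU)); rewrite mulmxKV// mulmxDl -xt.
    by rewrite subrK.
  rewrite !mxE; apply/esym/floor_def.
  have /andP[t0 t1] := t01 s.
  by rewrite lerDr t0 intrD addrC ltrD2l t1.
move=> ->.
exists (pos x *m invmx (basis G) -
        map_mx (fun z : int => z%:~R) (int_part x)); split.
  move=> s; rewrite !mxE subr_ge0 floor_le /=.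
  by rewrite ltrBlDl -intrD1 floorD1_gt.
by rewrite mulmxBl mulmxKV.
Qed.

Definition tau (e : edge G) : 'rV[int]_d :=
  int_part (term e) - int_part (orig e).
Definition qtau (E : qedge) : 'rV[int]_d := tau (erep E).

Lemma int_part_vshift m x : int_part (vshift m x) = m + int_part x.
Proof.
apply/esym/int_partP; rewrite pos_vshift -/(latvec m).
rewrite [X in cell (_ - X)](_ : _ = latvec m + latvec (int_part x)).
  by rewrite addrKA; apply/int_partP.
rewrite /latvec -mulmxDl; congr (_ *m _).
by apply/matrixP => i j; rewrite !mxE intrD.
Qed.

Lemma tau_eshift m e : tau (eshift m e) = tau e.
Proof.
rewrite /tau -!orig_erev erev_eshift !orig_eshift !int_part_vshift.
by rewrite opprD addrACA subrr add0r.
Qed.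

Variable V : vert G -> R.

Definition periodic_potential : Prop := forall m x, V (vshift m x) = V x.

Definition qpot (X : qvert) : R := V (vrep X).

Definition schroedinger (f : vert G -> Cx R) : vert G -> Cx R := fun x =>
  \sum_(e \in [set e | orig e = x]) f (term e) - (deg x)%:R * f x
  + toC (V x) * f x.

Definition fiber (k : 'rV[R]_d) (f : qvert -> Cx R) : qvert -> Cx R := fun X =>
  \sum_(E : qedge | qorig E == X) expi (pairing (qtau E) k) * f (qterm E)
  - (qdeg X)%:R * f X + toC (qpot X) * f X.

(* Oriented edges of the modified graph: [inr X] is the added loop at X. *)
Definition medge : finType := (qedge + qvert)%type.

Definition morig (a : medge) : qvert :=
  match a with inl E => qorig E | inr X => X end.
Definition mterm (a : medge) : qvert :=
  match a with inl E => qterm E | inr X => X end.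
Definition mtau (a : medge) : 'rV[int]_d :=
  match a with inl E => qtau E | inr _ => 0 end.
Definition mweight (a : medge) : R :=
  match a with inl _ => 1 | inr X => qpot X - (qdeg X)%:R end.

Definition is_cycle (c : seq medge) : bool :=
  (c != [::]) && path.cycle (fun a b => mterm a == morig b) c.

Definition ctau (c : seq medge) : 'rV[int]_d := \sum_(a <- c) mtau a.
Definition weight (c : seq medge) : R := \prod_(a <- c) mweight a.

Definition Tn (n : nat) (k : 'rV[R]_d) : R :=
  \sum_(c : n.-tuple medge | is_cycle c) weight c * cos (pairing (ctau c) k).

Definition Tnm (n : nat) (m : 'rV[int]_d) : R :=
  \sum_(c : n.-tuple medge | is_cycle c && (ctau c == m)) weight c.

(* A sum over all the cycles c satisfying P is a series over the length of c of
   finite sums. Summing in this order is necessary: as the weights of the added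
   loops have arbitrary signs, the family of the individual terms need not be
   summable for |lambda| > ||H||. *)
Definition by_length (P : pred (seq medge)) (F : seq medge -> Cx R) (n : nat) :
    Cx R :=
  \sum_(c : n.-tuple medge | is_cycle c && P c) F c.

Definition res_term (lambda : Cx R) (c : seq medge) : Cx R :=
  toC (weight c) / lambda ^+ (size c).+1.

Definition Rm (m : 'rV[int]_d) (lambda : Cx R) : Cx R :=
  csum1 (by_length (fun c => ctau c == m) (res_term lambda)).

End graph.

(* Main.v *)
Require Import Defs.
From HB Require Import structures.
From mathcomp Require Import all_boot all_order all_algebra.
From mathcomp Require Import finmap.
From mathcomp Require Import all_classical all_reals all_analysis.
From mathcomp Require Import measurable_realfun complex.
From mathcomp Require Import ring lra zify.
From mathcomp Require Import showcase.summability.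

(** H(k) is Hermitian, because reversing an edge changes the sign of its index;
    so Tr H(k)^n is a real power sum of the eigenvalues of H(k). Expanding the
    matrix power, it is also the sum of w(c) exp(i <tau(c), k>) over the cycles
    c of length n, and (1) is the geometric series of the resolvent.
    For (3), an eigenvector of H(k) extends to a bounded Bloch wave on the
    periodic graph; cut off to large boxes, it shows that every eigenvalue of
    every H(k) is at most ||H|| in modulus. The series (1) then converges
    boundedly in k and is integrated term by term.
    For (2), compactness of the torus (a Dini argument on the decreasing
    functions Tr (H(k)/|lambda|)^(2n)) bounds all the eigenvalues by some
    r < |lambda|. The Fourier coefficients of Tr H(k)^n are then at most nu r^n,
    and only O(n^d) of them are nonzero, so the double series over (n, m) is
    absolutely summable and can be rearranged. *)

Set Implicit Arguments.
Unset Strict Implicit.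
Unset Printing Implicit Defensive.
Import Order.TTheory GRing.Theory Num.Theory numFieldNormedType.Exports.

Local Open Scope classical_set_scope.
Local Open Scope ring_scope.

Section complex_modulus.
Variable R : realType.
Implicit Types (z w : Cx R) (x : R).

HB.instance Definition _ := GRing.RMorphism.copy (@toC R) (real_complex R).

Lemma toC_inj : injective (@toC R).
Proof. by move=> x y []. Qed.

Lemma toC_cabs z : toC (cabs z) = `|z|.
Proof. by []. Qed.

Lemma cabs0 : cabs (0 : Cx R) = 0.
Proof. exact: ComplexField.Normc.normc0. Qed.

Lemma cabs_ge0 z : 0 <= cabs z.
Proof. by rewrite -lecR; exact: (normr_ge0 z). Qed.

Lemma cabs_eq0 z : (cabs z == 0) = (z == 0).
Proof.
apply/eqP/eqP => [/ComplexField.Normc.eq0_normc //|->]; exact: cabs0.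
Qed.

Lemma cabsM z w : cabs (z * w) = cabs z * cabs w.
Proof. exact: ComplexField.Normc.normcM. Qed.

Lemma cabsV z : cabs z^-1 = (cabs z)^-1.
Proof. exact: ComplexField.Normc.normcV. Qed.

Lemma cabsX z n : cabs (z ^+ n) = cabs z ^+ n.
Proof.
by apply: toC_inj; rewrite rmorphXn /= !toC_cabs normrX.
Qed.

Lemma cabsN z : cabs (- z) = cabs z.
Proof. by apply: toC_inj; rewrite !toC_cabs normrN. Qed.

Lemma cabs_toC x : cabs (toC x) = `|x|.
Proof. by rewrite /cabs /toC /= expr0n addr0 sqrtr_sqr. Qed.

Lemma ler_cabsD z w : cabs (z + w) <= cabs z + cabs w.
Proof. exact: le_normcD. Qed.

Lemma ler_cabsB z w : cabs (z - w) <= cabs z + cabs w.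
Proof. by rewrite -[cabs w]cabsN ler_cabsD. Qed.

Lemma ler_cabs_sum I (r : seq I) (P : pred I) (F : I -> Cx R) :
  cabs (\sum_(i <- r | P i) F i) <= \sum_(i <- r | P i) cabs (F i).
Proof.
elim/big_rec2: _ => [|i y x _ le_yx]; first by rewrite cabs0.
by apply: le_trans (ler_cabsD _ _) _; rewrite lerD2l.
Qed.

Lemma ler_absRe_cabs z : `|complex.Re z| <= cabs z.
Proof. by rewrite -lecR; exact: normc_ge_Re. Qed.

Lemma ler_absIm_cabs z : `|complex.Im z| <= cabs z.
Proof.
rewrite -ler_sqr ?nnegrE ?cabs_ge0 // real_normK ?num_real //.
case: z => a b; rewrite /cabs /= sqr_sqrtr ?addr_ge0 ?sqr_ge0 //.
by rewrite lerDr sqr_ge0.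
Qed.

Lemma ler_cabs_ReIm z : cabs z <= `|complex.Re z| + `|complex.Im z|.
Proof.
case: z => a b; rewrite /cabs /=.
rewrite -ler_sqr ?nnegrE ?sqrtr_ge0 ?addr_ge0 //.
rewrite sqr_sqrtr ?addr_ge0 ?sqr_ge0 // sqrrD !real_normK ?num_real //.
by rewrite lerD2r lerDl mulrn_wge0 // mulr_ge0.
Qed.

Lemma ReD z w : complex.Re (z + w : R[i]) = complex.Re (z : R[i]) + complex.Re (w : R[i]).
Proof. by case: z w => ? ? []. Qed.

Lemma ImD z w : complex.Im (z + w : R[i]) = complex.Im (z : R[i]) + complex.Im (w : R[i]).
Proof. by case: z w => ? ? []. Qed.

Lemma ReB z w : complex.Re (z - w : R[i]) = complex.Re (z : R[i]) - complex.Re (w : R[i]).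
Proof. by case: z w => ? ? []. Qed.

Lemma ImB z w : complex.Im (z - w : R[i]) = complex.Im (z : R[i]) - complex.Im (w : R[i]).
Proof. by case: z w => ? ? []. Qed.

Lemma Re_toCM x z : complex.Re (toC x * z : R[i]) = x * complex.Re (z : R[i]).
Proof. by case: z => ? ? /=; rewrite mul0r subr0. Qed.

Lemma Im_toCM x z : complex.Im (toC x * z : R[i]) = x * complex.Im (z : R[i]).
Proof. by case: z => ? ? /=; rewrite mul0r addr0. Qed.

Lemma Re_sum I (r : seq I) (P : pred I) (F : I -> Cx R) :
  complex.Re (\sum_(i <- r | P i) F i : R[i]) = \sum_(i <- r | P i) complex.Re (F i : R[i]).
Proof. by elim/big_rec2: _ => // i y x _ <-; exact: ReD. Qed.

Lemma Im_sum I (r : seq I) (P : pred I) (F : I -> Cx R) :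
  complex.Im (\sum_(i <- r | P i) F i : R[i]) = \sum_(i <- r | P i) complex.Im (F i : R[i]).
Proof. by elim/big_rec2: _ => // i y x _ <-; exact: ImD. Qed.

Lemma conj_toC (x : R) : (toC x)^* = toC x.
Proof.
by apply: CrealP; apply/complex_realP; exists x.
Qed.

Lemma expiD (s t : R) : expi (s + t) = expi s * expi t :> Cx R.
Proof.
rewrite /expi cosD sinD; apply/eqP; rewrite eq_complex /=; apply/andP; split=> //.
by rewrite addrC.
Qed.

Lemma expi0 : expi 0 = 1 :> Cx R.
Proof. by rewrite /expi cos0 sin0. Qed.

Lemma expi_sum I (r : seq I) (P : pred I) (F : I -> R) :
  expi (\sum_(i <- r | P i) F i) = \prod_(i <- r | P i) expi (F i) :> Cx R.
Proof. by elim/big_rec2: _ => [|i y x _ <-]; rewrite ?expi0 ?expiD. Qed.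

Lemma cabs_expi (t : R) : cabs (expi t) = 1.
Proof. by rewrite /cabs /expi /= cos2Dsin2 sqrtr1. Qed.

Lemma conj_expi (t : R) : (expi t)^* = expi (- t).
Proof.
have e1 : expi t * expi (- t) = 1 :> Cx R by rewrite -expiD subrr expi0.
have e0 : expi t != 0 :> Cx R.
  by rewrite -cabs_eq0 cabs_expi oner_neq0.
apply: (mulfI e0); rewrite e1 -normCK -toC_cabs cabs_expi.
by rewrite -[toC 1]/(1 : Cx R) expr1n.
Qed.

Lemma expi_cos_sin (t : R) : expi t = toC (cos t) + 'i * toC (sin t).
Proof.
rewrite -complexiE; apply/eqP; rewrite eq_complex /=.
by rewrite !mul0r !mul1r ?mulr0 ?subr0 ?addr0 ?add0r !eqxx.
Qed.

End complex_modulus.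

Section complex_convergence.
Variable R : realType.
Implicit Types (u v : nat -> Cx R) (L : Cx R).

Lemma cvg_cabs (T : Type) (F : set_system T) (FF : Filter F) (u : T -> Cx R) L :
  (forall e : R, 0 < e -> \forall t \near F, cabs (u t - L) < e) ->
  u t @[t --> F] --> L.
Proof.
move=> H; apply/cvgrPdist_lt => e e0.
have [r re] : exists r, e = toC r by apply/complex_realP; exact: gtr0_real.
move: e0; rewrite re => r0.
have := H r; rewrite -(ltcR 0) => /(_ r0); apply: filterS => t.
by rewrite distrC -toC_cabs -ltcR.
Qed.

Lemma cvg_cabsP u L : u @ \oo --> L <-> cabs (u n - L) @[n --> \oo] --> (0 : R).
Proof.
split=> [/cvgrPdist_lt H|/cvgrPdist_lt H].
  apply/cvgrPdist_lt => e e0; have := H (toC e).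
  rewrite ltcR => /(_ e0); apply: filterS => n.
  rewrite sub0r normrN (ger0_norm (cabs_ge0 _)) => h.
  by rewrite -ltcR -[X in X < _]/(`|u n - L|) distrC.
apply: cvg_cabs => e /H; apply: filterS => n.
by rewrite sub0r normrN ger0_norm ?cabs_ge0.
Qed.

Lemma cvg_cabs_squeeze u L (e : nat -> R) :
  (forall n, cabs (u n - L) <= e n) -> e @ \oo --> (0 : R) -> u @ \oo --> L.
Proof.
move=> H e0; apply/cvg_cabsP; apply: (squeeze_cvgr _ (cvg_cst 0) e0).
by apply: nearW => n; rewrite cabs_ge0 H.
Qed.

Lemma cvg_ReIm u (a b : R) :
  complex.Re (u n : R[i]) @[n --> \oo] --> a ->
  complex.Im (u n : R[i]) @[n --> \oo] --> b ->
  u @ \oo --> (Complex a b : Cx R).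
Proof.
move=> ua ub; apply: (@cvg_cabs_squeeze _ _ (fun n =>
    `|complex.Re (u n : R[i]) - a| + `|complex.Im (u n : R[i]) - b|)) => [n|].
  by apply: le_trans (ler_cabs_ReIm _) _; rewrite ReB ImB.
rewrite -[0]addr0; apply: cvgD.
  by rewrite -(normr0 R) -[X in `|X|](subrr a); apply: cvg_norm; apply: cvgB ua (cvg_cst _).
by rewrite -(normr0 R) -[X in `|X|](subrr b); apply: cvg_norm; apply: cvgB ub (cvg_cst _).
Qed.

Lemma cvg_Re u L : u @ \oo --> L ->
  complex.Re (u n : R[i]) @[n --> \oo] --> complex.Re (L : R[i]).
Proof.
move/cvg_cabsP => uL; apply: cvg_zero.
apply: norm_cvg0; apply: (squeeze_cvgr _ (cvg_cst 0) uL).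
by apply: nearW => n; rewrite normr_ge0 -[X in `|X|]ReB ler_absRe_cabs.
Qed.

Lemma cvg_Im u L : u @ \oo --> L ->
  complex.Im (u n : R[i]) @[n --> \oo] --> complex.Im (L : R[i]).
Proof.
move/cvg_cabsP => uL; apply: cvg_zero.
apply: norm_cvg0; apply: (squeeze_cvgr _ (cvg_cst 0) uL).
by apply: nearW => n; rewrite normr_ge0 -[X in `|X|]ImB ler_absIm_cabs.
Qed.

Lemma csum1_eq u L : (fun N => \sum_(1 <= n < N) u n) @ \oo --> L -> csum1 u = L.
Proof. by move=> uL; apply: cvg_lim. Qed.

Lemma eq_csum1 u v : (forall n, (0 < n)%N -> u n = v n) -> csum1 u = csum1 v.
Proof.
move=> uv; congr (lim (_ @ \oo)); apply/funext => N.
by apply: eq_big_nat => n /andP[n0 _]; exact: uv.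
Qed.

Lemma eq_abs_cvg1 u v : (forall n, (0 < n)%N -> u n = v n) ->
  abs_cvg1 u -> abs_cvg1 v.
Proof.
move=> uv; rewrite /abs_cvg1 [X in cvgn X -> _](_ : _ =
  (fun N => \sum_(1 <= n < N) cabs (v n))) //.
apply/funext => N.
by apply: eq_big_nat => n /andP[n0 _]; rewrite uv.
Qed.

Lemma nondecreasing_sum1 (b : nat -> R) : (forall n, 0 <= b n) ->
  nondecreasing_seq (fun N => \sum_(1 <= n < N) b n).
Proof.
move=> b0; apply/nondecreasing_seqP => -[|N]; first by rewrite !big_geq.
by rewrite [leRHS]big_nat_recr //= lerDl.
Qed.

Lemma le_abs_cvg1 u (b : nat -> R) : (forall n, (0 < n)%N -> cabs (u n) <= b n) ->
  cvgn (fun N => \sum_(1 <= n < N) b n) -> abs_cvg1 u.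
Proof.
move=> ub /cvg_seq_bounded [M [_ /(_ (M + 1))]].
rewrite ltrDl ltr01 => /(_ isT) bM.
apply: nondecreasing_is_cvgn; first by apply: nondecreasing_sum1 => n; exact: cabs_ge0.
exists (M + 1) => _ [N _ <-]; apply: le_trans (bM N I) => /=.
apply: le_trans (ler_norm _); rewrite !big_nat; apply: ler_sum => n /andP[n0 _].
exact: ub.
Qed.

Lemma abs_cvg1_cvg u : abs_cvg1 u ->
  (fun N => \sum_(1 <= n < N) u n) @ \oo --> csum1 u.
Proof.
move=> cu.
have key (f : Cx R -> R) : (forall z, `|f z| <= cabs z) ->
    cvgn (fun N => \sum_(1 <= n < N) f (u n)).
  move=> fb.
  rewrite (is_cvg_series_restrict 1); apply: normed_cvg.
  apply: (@series_le_cvg _ _ (fun n => cabs (u n))) => [n|n|n|].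
  - exact: normr_ge0.
  - exact: cabs_ge0.
  - exact: fb.
  by rewrite -(is_cvg_series_restrict 1).
have cR := key (fun z => complex.Re (z : R[i])) (@ler_absRe_cabs R).
have cI := key (fun z => complex.Im (z : R[i])) (@ler_absIm_cabs R).
have cC := @cvg_ReIm (fun N => \sum_(1 <= n < N) u n) _ _.
have {}cC : (fun N => \sum_(1 <= n < N) u n) @ \oo -->
   (Complex (limn (fun N => \sum_(1 <= n < N) complex.Re (u n : R[i])))
     (limn (fun N => \sum_(1 <= n < N) complex.Im (u n : R[i]))) : Cx R).
  apply: cC.
    by under eq_fun do rewrite Re_sum; exact: cR.
  by under eq_fun do rewrite Im_sum; exact: cI.
by rewrite (csum1_eq cC).
Qed.

Lemma geometric_cvg0 (c q : R) : 0 <= q < 1 -> c * q ^+ n @[n --> \oo] --> (0 : R).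
Proof.
move=> /andP[q0 q1]; rewrite -[X in _ --> X](mulr0 c); apply: cvgM; first exact: cvg_cst.
by apply: cvg_expr; rewrite ger0_norm.
Qed.

End complex_convergence.

Section walks.
Variables (K : comNzRingType) (n : nat) (A : finType).
Variables (o t : A -> 'I_n) (W : A -> K).

Fixpoint walk (i : 'I_n) (c : seq A) (j : 'I_n) : bool :=
  if c is a :: c' then (o a == i) && walk (t a) c' j else i == j.

Definition walkmx : 'M[K]_n :=
  \matrix_(i, j) \sum_(a | (o a == i) && (t a == j)) W a.

Lemma big_tupleS m (P : pred (seq A)) (F : seq A -> K) :
  \sum_(c : m.+1.-tuple A | P c) F c =
  \sum_a \sum_(c : m.-tuple A | P (a :: c)) F (a :: c).
Proof.
rewrite pair_big_dep /=.
rewrite (reindex (fun p : A * m.-tuple A => [tuple of p.1 :: p.2])) //=.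
exists (fun c => (thead c, [tuple of behead c])) => [[a c] _|c _] /=.
  by congr pair; apply: val_inj.
by rewrite -tuple_eta.
Qed.

Lemma walkmx_expE m i j :
  (walkmx ^+ m) i j = \sum_(c : m.-tuple A | walk i c j) \prod_(a <- c) W a.
Proof.
elim: m i j => [|m IH] i j.
  rewrite expr0 mxE; case: eqVneq => [->|ij].
    rewrite (big_pred1 [tuple]) ?big_nil // => c /=.
    by rewrite tuple0 /= !eqxx.
  by rewrite big_pred0 // => c; rewrite tuple0 /= (negbTE ij).
rewrite exprS mxE (big_tupleS _ (fun c => walk i c j) (fun c => \prod_(a <- c) W a)).
under eq_bigr => k _ do rewrite mxE IH big_distrl.
rewrite /= (exchange_big_dep (fun a => o a == i)) /=; last first.
  by move=> k a _ /andP[].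
rewrite big_mkcond; apply: eq_bigr => a _; case: ifP => [oai|oai]; last first.
  by rewrite big_pred0.
rewrite (big_pred1 (t a)) => [|k] /=; last by rewrite oai eq_sym.
rewrite big_distrr /=; apply: eq_bigr => c _.
by rewrite big_cons.
Qed.

Lemma cycle_walk (r : rel A) c : (forall a b, r a b = (t a == o b)) ->
  (c != [::]) && cycle r c = (if c is a :: _ then walk (o a) c (o a) else false).
Proof.
move=> rE; case: c => //= a c; rewrite eqxx /=.
suff H b : path r a (rcons c b) = walk (t a) c (o b) by exact: H.
elim: c a => [|d c IH] a /=; first by rewrite rE andbT.
by rewrite rE IH eq_sym.
Qed.

Lemma mxtrace_walkmx_exp (r : rel A) m : (forall a b, r a b = (t a == o b)) ->
  \tr (walkmx ^+ m.+1) =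
  \sum_(c : m.+1.-tuple A | (tval c != [::]) && cycle r c) \prod_(a <- c) W a.
Proof.
move=> rE; rewrite /mxtrace.
under eq_bigr => i _ do rewrite walkmx_expE.
rewrite (exchange_big_dep (fun c : m.+1.-tuple A => (tval c != [::]) && cycle r c)) /=.
  apply: eq_bigr => c; case/tupleP: c => a c Hc.
  rewrite (big_pred1 (o a)) // => i /=.
  move: Hc; rewrite (@cycle_walk _ _ rE) /= eqxx /= => Hc.
  by rewrite eq_sym; case: eqVneq => [->|//]; rewrite Hc.
move=> i c _; case/tupleP: c => a c; rewrite (@cycle_walk _ _ rE) /= => /andP[/eqP <- ->].
by rewrite eqxx.
Qed.

End walks.

Section hermitian.
Variables (R : realType) (n : nat) (M : 'M[Cx R]_n).

(* The spectral decomposition M = P^-1 diag(D) P, read off through traces and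
   eigenvectors only. *)
Lemma hermitian_spectrum : (forall i j, M i j = (M j i)^*) ->
  exists D : 'I_n -> R,
  [/\ forall m, \tr (M ^+ m) = \sum_i toC (D i) ^+ m,
      forall i, exists2 g : 'cV[Cx R]_n, g != 0 & M *m g = toC (D i) *: g
    & forall l : Cx R, (forall i, toC (D i) != l) ->
      M - l%:M \in unitmx /\
      \tr (invmx (M - l%:M)) = \sum_i (toC (D i) - l)^-1 ].
Proof.
move=> Mh.
have Mherm : M \is hermsymmx.
  by apply/is_hermitianmxP; rewrite expr0 scale1r; apply/matrixP => i j; rewrite !mxE.
have /hermitian_normalmx/orthomx_spectralP := Mherm.
have := hermitian_spectral_diag_real Mherm.
have := spectral_unit M.
move: (spectralmx M) (spectral_diag M) => P d Pu dreal ME.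
have /all_sig[D DE] i : {D : R | d 0 i = toC D}.
  by apply: cid; have /mxOverP/(_ 0 i)/complex_realP[x ->] := dreal; exists x.
have trP X : \tr (invmx P *m X *m P) = \tr X.
  by rewrite mxtrace_mulC mulmxA mulmxV // mul1mx.
have PM X Y : (invmx P *m X *m P) *m (invmx P *m Y *m P) = invmx P *m (X *m Y) *m P.
  by rewrite !mulmxA mulmxK.
exists D; split.
- move=> m; suff -> : M ^+ m = invmx P *m diag_mx (\row_i (d 0 i) ^+ m) *m P.
    by rewrite trP mxtrace_diag; apply: eq_bigr => i _; rewrite mxE DE.
  elim: m => [|m IH].
    rewrite expr0 (_ : diag_mx _ = 1%:M) ?mulmx1 ?mulVmx //.
    by apply/matrixP => i j; rewrite !mxE expr0.
  rewrite exprS IH {1}ME; rewrite -[LHS]/(_ *m _) PM mulmx_diag.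
  by congr (_ *m diag_mx _ *m _); apply/rowP => i; rewrite !mxE exprS.
- move=> i; exists (invmx P *m delta_mx i 0).
    apply/eqP => /(congr1 (mulmx P)); rewrite mulmxA mulmxV // mul1mx mulmx0.
    by move=> /matrixP/(_ i 0); rewrite !mxE !eqxx => /eqP; rewrite oner_eq0.
  rewrite {1}ME !mulmxA mulmxK // -!mulmxA scalemxAr; congr (_ *m _).
  apply/matrixP => a b; rewrite !mxE (bigD1 i) //= !mxE !eqxx /= big1; last first.
    by move=> k ki; rewrite !mxE (negbTE ki) /= mulr0.
  rewrite addr0 mulrC; case: (eqVneq a i) => [->|ai] /=.
    by rewrite (ord1 b) eqxx !mulr1n mul1r mulr1 DE.
  by rewrite mulr0n !mulr0.
move=> l Dl.
have ML : M - l%:M = invmx P *m diag_mx (\row_i (d 0 i - l)) *m P.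
  rewrite (_ : diag_mx _ = diag_mx d - l%:M); last first.
    by apply/matrixP => i j; rewrite !mxE mulrnBl.
  by rewrite mulmxBr mulmxBl -ME mul_mx_scalar -scalemxAl mulVmx // scalemx1.
have MB : (M - l%:M) *m (invmx P *m diag_mx (\row_i (d 0 i - l)^-1) *m P) = 1%:M.
  rewrite ML PM mulmx_diag (_ : diag_mx _ = 1%:M) ?mulmx1 ?mulVmx //.
  apply/matrixP => i j; rewrite !mxE mulfV //.
  by rewrite subr_eq0 DE Dl.
have [MLu _] := mulmx1_unit MB; split=> //.
rewrite -[invmx _]mulmx1 -MB mulKmx // trP mxtrace_diag.
by apply: eq_bigr => i _; rewrite mxE DE.
Qed.

End hermitian.

Lemma resolvent_geometric (R : realType) (x l : Cx R) N : l != 0 -> x != l ->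
  (x - l)^-1 + \sum_(0 <= n < N) x ^+ n / l ^+ n.+1 = (x / l) ^+ N / (x - l).
Proof.
move=> l0 xl; have xl0 : x - l != 0 by rewrite subr_eq0.
elim: N => [|N IH]; first by rewrite big_geq // expr0 addr0 mul1r.
rewrite big_nat_recr //= addrA IH.
rewrite (_ : x ^+ N / l ^+ N.+1 = (x / l) ^+ N / l); last first.
  by rewrite exprMn exprVn exprSr invfM mulrA mulrAC.
rewrite exprSr; move: ((x / l) ^+ N) => q; field.
by rewrite l0 xl0.
Qed.

Section quotient_graph.
Variables (R : realType) (d : nat) (G : periodic_graph R d).
Implicit Types (x y : vert G) (e : edge G) (X : qvert G) (E : qedge G).

Lemma latvec_inj : injective (latvec G).
Proof.
move=> m n /(can_inj (mulmxK (basis_unit G))) /matrixP mn; apply/matrixP => i j.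
by have := mn i j; rewrite !mxE => /eqP; rewrite eqr_int => /eqP.
Qed.

Lemma vshift0 x : vshift 0 x = x.
Proof.
apply: pos_inj; rewrite pos_vshift (_ : map_mx _ 0 = 0) ?mul0mx ?addr0 //.
by apply/matrixP => i j; rewrite !mxE.
Qed.

Lemma vshiftD m n x : vshift (m + n) x = vshift m (vshift n x).
Proof.
apply: pos_inj; rewrite !pos_vshift -addrA -mulmxDl; congr (_ + _ *m _).
by apply/matrixP => i j; rewrite !mxE intrD addrC.
Qed.

Lemma vshift_inj x : injective (fun m => vshift m x).
Proof.
move=> m n /(congr1 (@pos _ _ G)); rewrite !pos_vshift => /addrI.
exact: latvec_inj.
Qed.

Lemma term_eshift m e : term (eshift m e) = vshift m (term e).
Proof. by rewrite -!orig_erev erev_eshift orig_eshift. Qed.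

Lemma vrepK X : vproj (vrep X) = X.
Proof. exact: (projT2 (cid (vproj_surj X))). Qed.

Lemma erepK E : eproj (erep E) = E.
Proof. exact: (projT2 (cid (eproj_surj E))). Qed.

Lemma vproj_vshift m x : vproj (vshift m x) = vproj x.
Proof.
apply: val_inj; apply/seteqP; split=> y [n ->].
  by exists (n + m); rewrite vshiftD.
by exists (n - m); rewrite -vshiftD subrK.
Qed.

Lemma vprojP x y : vproj x = vproj y -> exists m, y = vshift m x.
Proof.
move=> /(congr1 val) /= xy; have : vorbit y y by exists 0; rewrite vshift0.
by rewrite -xy.
Qed.

Lemma eproj_eshift m e : eproj (eshift m e) = eproj e.
Proof.
apply: val_inj; apply/seteqP; split=> y [n ->].
  by exists (n + m); rewrite eshiftD.
by exists (n - m); rewrite -eshiftD subrK.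
Qed.

Lemma eprojP e e' : eproj e = eproj e' -> exists m, e' = eshift m e.
Proof.
move=> /(congr1 val) /= xy; have : eorbit e' e' by exists 0; rewrite eshift0.
by rewrite -xy.
Qed.

Lemma erep_eproj e : exists m, erep (eproj e) = eshift m e.
Proof. by apply: eprojP; rewrite erepK. Qed.

Lemma qorig_eproj e : qorig (eproj e) = vproj (orig e).
Proof. by rewrite /qorig; have [m ->] := erep_eproj e; rewrite orig_eshift vproj_vshift. Qed.

Lemma qterm_eproj e : qterm (eproj e) = vproj (term e).
Proof. by rewrite /qterm; have [m ->] := erep_eproj e; rewrite term_eshift vproj_vshift. Qed.

Lemma qtau_eproj e : qtau (eproj e) = tau e.
Proof. by rewrite /qtau; have [m ->] := erep_eproj e; rewrite tau_eshift. Qed.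

Definition qrev E : qedge G := eproj (erev (erep E)).

Lemma qrevK : involutive qrev.
Proof.
move=> E; rewrite /qrev; have [m ->] := erep_eproj (erev (erep E)).
by rewrite erev_eshift eproj_eshift erevK erepK.
Qed.

Lemma term_erev e : term (erev e) = orig e.
Proof. by rewrite -orig_erev erevK. Qed.

Lemma qorig_qrev E : qorig (qrev E) = qterm E.
Proof. by rewrite qorig_eproj orig_erev. Qed.

Lemma qterm_qrev E : qterm (qrev E) = qorig E.
Proof. by rewrite qterm_eproj term_erev. Qed.

Lemma qtau_qrev E : qtau (qrev E) = - qtau E.
Proof. by rewrite qtau_eproj /qtau /tau orig_erev term_erev opprB. Qed.

(* The translations act freely, so the edges issued from a vertex are in
   bijection with those issued from its projection. *)
Lemma star_bij x :
  set_bij [set e | orig e = x] [set E | qorig E = vproj x] (@eproj _ _ G).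
Proof.
split.
- by move=> e /= <-; rewrite qorig_eproj.
- move=> e e'; rewrite !inE /= => ex e'x /eprojP[m e'E].
  have : vshift m x = vshift 0 x by rewrite vshift0 -{1}ex -orig_eshift -e'E.
  by move/vshift_inj => m0; rewrite e'E m0 eshift0.
move=> E /= Ex; have /vprojP[m xE] : vproj (orig (erep E)) = vproj x by [].
by exists (eshift m (erep E)) => /=; rewrite ?orig_eshift // eproj_eshift erepK.
Qed.

Lemma big_star (K : nmodType) (F : qedge G -> K) x :
  \sum_(e \in [set e | orig e = x]) F (eproj e) =
  \sum_(E | qorig E == vproj x) F E.
Proof.
rewrite -(reindex_fsbig _ _ _ _ (star_bij x)).
rewrite (fsbigE [seq E <- index_enum (qedge G) | qorig E == vproj x]) /=.
- rewrite big_filter_cond; apply: eq_bigl => E.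
  by rewrite andb_idr // => /eqP Ex; rewrite inE.
- by rewrite filter_uniq ?index_enum_uniq.
- by move=> E /=; rewrite mem_filter => /andP[/eqP].
by move=> E /= Ex; rewrite mem_filter Ex eqxx mem_index_enum.
Qed.

Lemma qdeg_vproj x : qdeg (vproj x) = deg x.
Proof.
have degE y : deg y = (\sum_(E : qedge G | qorig E == vproj y) 1)%N.
  have := @big_star nat (fun=> 1%N) y.
  rewrite fsbig_finite /=; last exact: locally_finite.
  by rewrite sum1_size.
by rewrite /qdeg !degE vrepK.
Qed.

Lemma vert_coord x :
  x = vshift (int_part x - int_part (vrep (vproj x))) (vrep (vproj x)).
Proof.
have [m xE] : exists m, x = vshift m (vrep (vproj x)) by apply: vprojP; rewrite vrepK.
by rewrite {2}xE int_part_vshift addrK -xE.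
Qed.

Lemma pairingD (m n : 'rV[int]_d) (k : 'rV[R]_d) :
  pairing (m + n) k = pairing m k + pairing n k.
Proof. by rewrite /pairing -big_split; apply: eq_bigr => i _; rewrite mxE intrD mulrDl. Qed.

Lemma pairingN (m : 'rV[int]_d) (k : 'rV[R]_d) : pairing (- m) k = - pairing m k.
Proof. by rewrite /pairing -sumrN; apply: eq_bigr => i _; rewrite mxE mulrNz mulNr. Qed.

Lemma pairing0 (k : 'rV[R]_d) : pairing 0 k = 0.
Proof. by rewrite /pairing big1 // => i _; rewrite mxE mul0r. Qed.

Lemma pairing_sum I (r : seq I) (F : I -> 'rV[int]_d) (k : 'rV[R]_d) :
  pairing (\sum_(i <- r) F i) k = \sum_(i <- r) pairing (F i) k.
Proof. by elim/big_rec2: _ => [|i y x _ <-]; rewrite ?pairing0 ?pairingD. Qed.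

Section fiber_operator.
Variable V : vert G -> R.

Lemma qpot_vproj x : periodic_potential V -> qpot V (vproj x) = V x.
Proof. by move=> hV; rewrite {2}(vert_coord x) hV. Qed.

Definition bloch_weight (k : 'rV[R]_d) (a : medge G) : Cx R :=
  toC (mweight V a) * expi (pairing (mtau a) k).

Lemma fiberE k f X :
  fiber V k f X =
  \sum_(a : medge G | morig a == X) bloch_weight k a * f (mterm a).
Proof.
rewrite big_sumType /= /fiber -addrA; congr (_ + _).
  by apply: eq_bigr => E _; rewrite /bloch_weight /= rmorph1 mul1r.
rewrite (big_pred1 X) // /bloch_weight /= pairing0 expi0 mulr1 rmorphB /= rmorph_nat.
by rewrite mulrBl addrC.
Qed.

Lemma opmx_fiberE k :
  opmx (fiber V k) =
  walkmx (fun a : medge G => enum_rank (morig a)) (fun a => enum_rank (mterm a))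
    (bloch_weight k).
Proof.
have er (X : qvert G) i : (enum_rank X == i) = (X == enum_val i).
  by apply/eqP/eqP => [<-|->]; rewrite ?enum_rankK ?enum_valK.
apply/matrixP => i j; rewrite !mxE fiberE big_mkcond [RHS]big_mkcond /=.
apply: eq_bigr => a _; rewrite !er; case: ifP => //= _.
by case: eqP; rewrite ?mulr1 ?mulr0.
Qed.

Definition mrev (a : medge G) : medge G :=
  match a with inl E => inl (qrev E) | inr X => inr X end.

Lemma mrevK : involutive mrev.
Proof. by case=> //= E; rewrite qrevK. Qed.

Lemma opmx_fiber_hermitian k i j :
  opmx (fiber V k) i j = (opmx (fiber V k) j i)^*.
Proof.
rewrite opmx_fiberE !mxE rmorph_sum /= (reindex_inj (inv_inj mrevK)) /=.
apply: eq_big => [[E|X]|[E|X] _] /=; rewrite ?qorig_qrev ?qterm_qrev ?(andbC (_ == i)) //.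
  by rewrite /bloch_weight rmorphM /= conj_toC conj_expi qtau_qrev pairingN.
by rewrite /bloch_weight rmorphM /= conj_toC conj_expi pairing0 oppr0.
Qed.

Lemma mxtrace_opmx_fiber_exp k n : (0 < n)%N ->
  \tr (opmx (fiber V k) ^+ n) =
  \sum_(c : n.-tuple (medge G) | is_cycle c) toC (weight V c) * expi (pairing (ctau c) k).
Proof.
case: n => // n _; rewrite opmx_fiberE.
rewrite (@mxtrace_walkmx_exp _ _ _ _ _ _ (fun a b : medge G => mterm a == morig b)).
  apply: eq_bigr => c _; rewrite big_split /= -rmorph_prod /= -expi_sum.
  by rewrite /ctau pairing_sum.
by move=> a b; rewrite (inj_eq enum_rank_inj).
Qed.

Lemma fiber_spectrum k : exists D : 'I_#|qvert G| -> R,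
  [/\ forall n, (0 < n)%N ->
        \sum_(c : n.-tuple (medge G) | is_cycle c)
          toC (weight V c) * expi (pairing (ctau c) k) = toC (\sum_i D i ^+ n),
      forall i, exists g : qvert G -> Cx R,
        (exists X, g X != 0) /\ (forall X, fiber V k g X = toC (D i) * g X)
    & forall l : Cx R, (forall i, toC (D i) != l) ->
      opmx (fiber V k) - l%:M \in unitmx /\
      tr_resolvent (fiber V k) l = \sum_i (toC (D i) - l)^-1 ].
Proof.
have [D [Dtr Deig Dres]] := hermitian_spectrum (opmx_fiber_hermitian k).
exists D; split=> // [n n0|i].
  rewrite -mxtrace_opmx_fiber_exp // Dtr rmorph_sum /=.
  by apply: eq_bigr => i _; rewrite rmorphXn.
have [g g0 gE] := Deig i; exists (fun X => g (enum_rank X) 0); split.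
  apply: contra_neqP g0 => g0; apply/matrixP => j z; rewrite ord1 mxE.
  apply/eqP; apply: contra_notT g0 => gj; exists (enum_val j); by rewrite enum_valK.
move=> X; have /matrixP/(_ (enum_rank X) 0) := gE; rewrite !mxE => <-.
rewrite fiberE opmx_fiberE /=; symmetry.
under eq_bigr => j _ do rewrite mxE big_distrl /=.
rewrite (exchange_big_dep (fun a : medge G => morig a == X)) /=; last first.
  by move=> j a _ /andP[/eqP/enum_rank_inj ->].
apply: eq_bigr => a /eqP ax; rewrite (big_pred1 (enum_rank (mterm a))) // => j /=.
by rewrite ax eqxx eq_sym.
Qed.

End fiber_operator.

End quotient_graph.

Section operator_norm.
Variable R : realType.

Lemma opnorm_lt_ex (X : choiceType) (T : (X -> Cx R) -> (X -> Cx R)) (s : R) :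
  (opnorm T < s%:E)%E -> 0 < s ->
  exists r : R, [/\ 0 <= r, r < s & (opnorm T <= r%:E)%E].
Proof.
case: (opnorm T) => [x|//|] Ts s0; last by exists 0; rewrite leNye.
by exists (Num.max 0 x); rewrite le_max lexx gt_max s0 lee_fin le_max lexx orbT.
Qed.

Lemma esum_seq (X : choiceType) (A : seq X) (h : X -> R) : uniq A ->
  (forall x, 0 <= h x) -> (forall x, x \notin A -> h x = 0) ->
  (\esum_(x in [set: X]) (h x)%:E = (\sum_(x <- A) h x)%:E)%E.
Proof.
move=> uA h0 hA.
have -> : (\esum_(x in [set: X]) (h x)%:E = \esum_(x in [set` A]) (h x)%:E)%E.
  rewrite [RHS]esum_mkcond; apply: eq_esum => x _.
  by case: ifPn => // /negP xA; rewrite hA //; apply/negP => xA'; apply: xA; rewrite inE.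
rewrite esum_fset //; last by move=> x _; rewrite lee_fin.
by rewrite -fsbig_seq // sumEFin.
Qed.

Lemma opnorm_bound (X : choiceType) (T : (X -> Cx R) -> (X -> Cx R)) (f : X -> Cx R)
    (A B : seq X) (r : R) :
  uniq A -> uniq B -> (forall x, x \notin A -> f x = 0) ->
  (forall (c : R) x, T (fun y => toC c * f y) x = toC c * T f x) ->
  0 <= r -> (opnorm T <= r%:E)%E ->
  \sum_(x <- B) cabs (T f x) ^+ 2 <= r ^+ 2 * \sum_(x <- A) cabs (f x) ^+ 2.
Proof.
move=> uA uB fA Tf r0 Tr; set S := \sum_(x <- A) _.
have S0 : 0 <= S by apply: sumr_ge0 => x _; rewrite sqr_ge0.
move: S0; rewrite le_eqVlt => /predU1P[/esym S0|S0].
  have f0 x : f x = 0.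
    have [xA|/fA //] := boolP (x \in A).
    have /eqP := S0; rewrite psumr_eq0; last by move=> y _; rewrite sqr_ge0.
    by move=> /allP/(_ x xA); rewrite expf_eq0 cabs_eq0 => /eqP.
  have fE : f = (fun y => toC 0 * f y) by apply/funext => y; rewrite f0 mulr0.
  rewrite big1 ?mulr_ge0 ?sqr_ge0 ?S0 // => x _.
  by rewrite fE Tf rmorph0 mul0r cabs0 expr0n.
pose c := (Num.sqrt S)^-1.
have c2 : c ^+ 2 = S^-1 by rewrite exprVn sqr_sqrtr // ltW.
have cabsc z : cabs (toC c * z) ^+ 2 = S^-1 * cabs z ^+ 2.
  by rewrite cabsM exprMn cabs_toC real_normK ?num_real // c2.
pose f' y := toC c * f y.
have f'1 : l2norm f' = 1%E.
  rewrite /l2norm (@esum_seq _ A) // => [|x|x /fA xA]; last 2 first.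
  - by rewrite sqr_ge0.
  - by rewrite /f' xA mulr0 cabs0 expr0n.
  under eq_bigr do rewrite cabsc.
  by rewrite -mulr_sumr mulVf ?gt_eqF //= sqrtr1.
have : (l2norm (T f') <= r%:E)%E.
  by apply: le_trans Tr; apply: ereal_sup_ubound; exists f' => //=; rewrite f'1.
rewrite /l2norm -(ger0_norm r0) -[X in (_ <= X)%E]/(`|r%:E|)%E -sqrte_sqr.
rewrite lee_sqrt ?expe_ge0 ?lee_fin //= => H.
have : (\sum_(x <- B) S^-1 * cabs (T f x) ^+ 2 <= r ^+ 2).
  rewrite -lee_fin expr2; apply: le_trans H; apply: esum_ge.
  exists [set` B]; first by split=> //; exact: finite_set_seq.
  rewrite -fsbig_seq // sumEFin lee_fin; apply: ler_sum => x _.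
  by rewrite Tf cabsc.
by rewrite (ger0_norm r0) -mulr_sumr mulrC ler_pdivrMr.
Qed.

End operator_norm.

Section spectral_bounds.
Variables (R : realType) (d : nat) (G : periodic_graph R d) (V : vert G -> R).
Variables (k : 'rV[R]_d) (mu : R) (g : qvert G -> Cx R).
Hypothesis g_neq0 : exists X, g X != 0.
Hypothesis fiber_g : forall X, fiber V k g X = toC mu * g X.

Let S := \sum_X cabs (g X) ^+ 2.

Let S_gt0 : 0 < S.
Proof.
have [X gX] := g_neq0; rewrite /S (bigD1 X) //= ltr_wpDr //.
  by apply: sumr_ge0 => Y _; rewrite sqr_ge0.
by rewrite exprn_gt0 // lt_neqAle eq_sym cabs_eq0 gX cabs_ge0.
Qed.

Lemma fiber_eigenvalue_bound r : 0 <= r -> (opnorm (fiber V k) <= r%:E)%E -> `|mu| <= r.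
Proof.
move=> r0 Tr; have := @opnorm_bound _ _ (fiber V k) g (index_enum (qvert G)) (index_enum (qvert G)) r.
move=> /(_ (index_enum_uniq _) (index_enum_uniq _)) H.
have {H} := H _ _ r0 Tr.
have -> : \sum_X cabs (fiber V k g X) ^+ 2 = `|mu| ^+ 2 * S.
  rewrite /S mulr_sumr; apply: eq_bigr => X _.
  by rewrite fiber_g cabsM cabs_toC exprMn.
rewrite ler_pM2r // ler_sqr ?nnegrE //; apply=> [X|c X].
  by rewrite mem_index_enum.
rewrite !fiberE mulr_sumr; apply: eq_bigr => a _; by rewrite mulrCA.
Qed.

Hypothesis hV : periodic_potential V.

Let bloch (x : vert G) : Cx R := expi (pairing (int_part x) k) * g (vproj x).

Let cabs_bloch x : cabs (bloch x) = cabs (g (vproj x)).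
Proof. by rewrite cabsM cabs_expi mul1r. Qed.

Lemma schroedinger_bloch x : schroedinger V bloch x = toC mu * bloch x.
Proof.
rewrite [RHS]mulrCA -fiber_g /fiber /schroedinger.
rewrite mulrDr mulrBr; congr (_ - _ + _).
- rewrite mulr_sumr -big_star; apply: eq_fsbigr => e; rewrite inE /= => ex.
  rewrite /bloch qtau_eproj qterm_eproj mulrA -expiD -pairingD; congr (expi (pairing _ _) * _).
  by rewrite /tau ex addrC subrK.
- by rewrite qdeg_vproj mulrCA.
by rewrite qpot_vproj // mulrCA.
Qed.

Let box_point (o N : nat) (q : qvert G * {ffun 'I_d -> 'I_N.+1}) : vert G :=
  vshift (\row_s (o + q.2 s)%:Z - int_part (vrep q.1)) (vrep q.1).

Let box (o N : nat) : seq (vert G) :=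
  [seq box_point o q | q <- enum {: qvert G * {ffun 'I_d -> 'I_N.+1}}].

Let int_part_box o N (q : qvert G * {ffun 'I_d -> 'I_N.+1}) :
  int_part (box_point o q) = \row_s (o + q.2 s)%:Z.
Proof. by rewrite int_part_vshift subrK. Qed.

Let vproj_box o N (q : qvert G * {ffun 'I_d -> 'I_N.+1}) : vproj (box_point o q) = q.1.
Proof. by rewrite vproj_vshift vrepK. Qed.

Let box_uniq o N : uniq (box o N).
Proof.
rewrite map_inj_uniq ?enum_uniq // => q q' qq'.
have := congr1 (@int_part _ _ _) qq'; rewrite !int_part_box => /rowP qs.
have := congr1 (@vproj _ _ _) qq'; rewrite !vproj_box => q1.
case: q q' {qq'} q1 qs => [X p] [X' p'] /= -> qs; congr pair.
by apply/ffunP => s; have := qs s; rewrite !mxE => -[/addnI /val_inj].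
Qed.

Let mem_box o N x :
  x \in box o N <-> forall s, (o%:Z <= int_part x 0 s < (o + N.+1)%N%:Z).
Proof.
split=> [/mapP[q _ ->] s|xs].
  rewrite int_part_box mxE lez_nat ltz_nat leq_addr ltn_add2l /=.
  exact: ltn_ord.
apply/mapP.
have pP s : (absz (int_part x 0%R s - o%:Z)%R < N.+1)%N by have := xs s; lia.
exists (vproj x, [ffun s => Ordinal (pP s)]); first by rewrite mem_enum.
rewrite {1}(vert_coord x) /box_point /=; congr (vshift (_ - _) _).
by apply/rowP => s; rewrite [RHS]mxE ffunE /=; have := xs s; lia.
Qed.

Let sum_box o N : \sum_(x <- box o N) cabs (bloch x) ^+ 2 = (N.+1 ^ d)%:R * S.
Proof.
rewrite big_map big_enum /=.
under eq_bigr do rewrite cabs_bloch vproj_box.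
rewrite -(pair_bigA _ (fun X (p : {ffun 'I_d -> 'I_N.+1}) => cabs (g X) ^+ 2)) /=.
rewrite /S mulr_sumr; apply: eq_bigr => X _.
by rewrite sumr_const card_ffun !card_ord mulr_natl.
Qed.

Let tau_bound : exists D : nat, forall (e : edge G) (s : 'I_d), (absz (tau e 0%R s) <= D)%N.
Proof.
exists (\max_(E : qedge G) \max_(s < d) absz (qtau E 0%R s)) => e s.
rewrite -qtau_eproj; apply: leq_trans (leq_bigmax (eproj e)) => /=.
exact: (@leq_bigmax _ (fun s => absz (qtau (eproj e) 0%R s)) s).
Qed.

(* The Bloch wave is cut off to large boxes, which form a Folner sequence. *)
Lemma schroedinger_eigenvalue_bound r : 0 <= r ->
  (opnorm (schroedinger V) <= r%:E)%E -> `|mu| <= r.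
Proof.
move=> r0 Tr; have [D tauD] := tau_bound.
have key (N : nat) : (N.+1 ^ d)%:R * (`|mu| ^+ 2) <= ((N + 2 * D).+1 ^ d)%:R * r ^+ 2.
  pose f x := if x \in box 0 (N + 2 * D) then bloch x else 0.
  have := @opnorm_bound _ _ (schroedinger V) f (box 0 (N + 2 * D)) (box D N) r
    (box_uniq _ _) (box_uniq _ _) _ _ r0 Tr.
  rewrite (_ : \sum_(x <- box D N) _ = `|mu| ^+ 2 * ((N.+1 ^ d)%:R * S)); last first.
    rewrite -(sum_box D) mulr_sumr; apply: eq_big_seq => x xD.
    rewrite -exprMn -cabs_toC -cabsM -schroedinger_bloch; congr (cabs _ ^+ 2).
    have fx : f x = bloch x.
      rewrite /f ifT //; apply/mem_box => s.
      by move/mem_box : xD => /(_ s); lia.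
    rewrite /schroedinger fx; congr (_ - _ + _); apply: eq_fsbigr => e; rewrite inE /= => ex.
    rewrite /f ifT //; apply/mem_box => s.
    have := tauD e s; rewrite /tau ex mxE [X in (_ + X)%R]mxE.
    move/mem_box : xD => /(_ s).
    by move: (int_part x 0 s) (int_part (term e) 0 s) => a b; lia.
  rewrite (_ : \sum_(x <- box 0 _) _ = ((N + 2 * D).+1 ^ d)%:R * S); last first.
    rewrite -(sum_box 0); apply: eq_big_seq => x xA.
    by rewrite /f xA.
  rewrite (mulrA (`|mu| ^+ 2)) (mulrA (r ^+ 2)) (ler_pM2r S_gt0) (mulrC (`|mu| ^+ 2)) (mulrC (r ^+ 2)).
  move=> H; have {}H := H _ _; apply: H => [x xA|c x]; first by rewrite /f (negbTE xA).
  rewrite /schroedinger !mulrDr mulrN; congr (_ - _ + _); rewrite 1?mulrCA //.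
  by rewrite !fsbig_finite /= ?mulr_sumr //; exact: locally_finite.
rewrite -ler_sqr ?nnegrE //.
have lim1 : 1 + (2 * D)%:R * @harmonic R n @[n --> \oo] --> (1 : R).
  rewrite -[X in _ --> X]addr0; apply: cvgD; first exact: cvg_cst.
  rewrite -[X in _ --> X](mulr0 (2 * D)%:R); apply: cvgM; first exact: cvg_cst.
  exact: cvg_harmonic.
have lim : (1 + (2 * D)%:R * @harmonic R n) ^+ d * r ^+ 2 @[n --> \oo] --> r ^+ 2.
  rewrite -[X in _ --> X]mul1r; apply: cvgM; last exact: cvg_cst.
  rewrite -[X in _ --> X](expr1n R d).
  exact: cvg_comp lim1 (@exprn_continuous R d 1).
apply: (cvgr_to_ge lim); apply: nearW => N.
have N0 : 0 < N.+1%:R ^+ d :> R by rewrite exprn_gt0.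
have e : N.+1%:R * (1 + (2 * D)%:R * @harmonic R N) = (N + 2 * D).+1%:R.
  rewrite /harmonic /= -addSn natrD.
  by rewrite mulrDr mulr1 (mulrC _ N.+1%:R^-1) mulVKf ?pnatr_eq0.
by rewrite -(ler_pM2l N0) [leRHS]mulrA -exprMn e -!natrX; exact: key.
Qed.

End spectral_bounds.

Section torus_integrals.
Variable R : realType.
Notation leb := (@lebesgue_measure R).

Definition circle : set (measurableTypeR R) := [set x | 0 <= x < 2 * pi].

Lemma circleE : circle = `[0, 2 * pi[%classic.
Proof. by apply/seteqP; split=> x /=; rewrite in_itv. Qed.

Lemma cos_sin_2pi_int (z : int) :
  cos (z%:~R * (2 * pi)) = 1 :> R /\ sin (z%:~R * (2 * pi)) = 0 :> R.
Proof.
have H (n : nat) : cos (n%:R * (2 * pi)) = 1 :> R /\ sin (n%:R * (2 * pi)) = 0 :> R.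
  elim: n => [|n [IHc IHs]]; first by rewrite mul0r cos0 sin0.
  rewrite -addn1 natrD mulrDl mul1r cosD sinD IHc IHs !mul0r !mul1r subr0 add0r.
  by rewrite mulr_natl sin_mulr2n sinpi mulr0 mul0rn cos2pi.
case: z => n; first exact: H.
have [Hc Hs] := H n.+1.
by rewrite NegzE mulrNz mulNr cosN sinN Hc Hs oppr0.
Qed.

Lemma integral_cos_circle (a : R) (z : int) :
  (\int[leb]_(x in circle) (cos (a + z%:~R * x))%:E =
   (if z == 0 then 2 * pi * cos a else 0)%:E)%E.
Proof.
have p2 : 0 < 2 * pi :> R by rewrite mulr_gt0 ?pi_gt0.
have cf : continuous (fun x : R => cos (a + z%:~R * x)).
  move=> x; apply: continuous_comp; last exact: continuous_cos.
  apply: continuousD; first exact: cst_continuous.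
  by apply: continuousM; [exact: cst_continuous|exact: cvg_id].
rewrite circleE integral_itv_bndo_bndc; last first.
  by apply/measurable_EFinP; apply: measurable_funTS; exact: continuous_measurable_fun.
case: eqP => [->|/eqP z0].
  under eq_integral do rewrite mul0r addr0.
  rewrite integral_cst //= lebesgue_measure_itv /= lte_fin p2 sube0.
  by rewrite -EFinM mulrC.
have zR : z%:~R != 0 :> R by rewrite intr_eq0.
pose F x : R := sin (a + z%:~R * x) / z%:~R.
have dF (x : R) : is_derive x 1 F (cos (a + z%:~R * x)).
  have dg : is_derive x 1 (cst a + z%:~R *: (@id R) : R -> R) z%:~R.
    by apply: is_derive_eq; rewrite add0r -[X in X = _]/(_ * _) mulr1.
  have dsg := is_derive1_comp (is_derive_sin _) dg.
  rewrite (_ : F = z%:~R^-1 \*: (sin \o (cst a + z%:~R *: (@id R) : R -> R))); last first.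
    by apply/funext => y; rewrite /F mulrC.
  apply: (is_derive_eq (is_deriveZ (z%:~R^-1) dsg)).
  by rewrite -[LHS]/(_ * (_ * _)) mulrC mulfK.
have cF : continuous F.
  move=> x; apply: differentiable_continuous; apply/derivable1_diffP.
  exact: (@ex_derive _ _ _ _ _ _ _ (dF x)).
rewrite (@continuous_FTC2 _ _ F) //.
- by rewrite -EFinB /F mulr0 addr0 sinD (proj1 (cos_sin_2pi_int z)) (proj2 (cos_sin_2pi_int z))
    mulr1 mulr0 addr0 subrr.
- exact: continuous_subspaceT.
- split.
  + by move=> x _; exact: (@ex_derive _ _ _ _ _ _ _ (dF x)).
  + by apply: cvg_at_right_filter; exact: cF.
  + by apply: cvg_at_left_filter; exact: cF.
by move=> x _; rewrite derive1E; exact: derive_val.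
Qed.

Lemma circle_measure : leb circle = (2 * pi)%:E.
Proof.
by rewrite circleE lebesgue_measure_itv /= lte_fin mulr_gt0 ?pi_gt0 // sube0.
Qed.

Lemma measurable_circle : measurable circle.
Proof. by rewrite circleE; exact: measurable_itv. Qed.

Lemma measurable_torus_box d : measurable (@torus_box R d).
Proof.
rewrite (_ : @torus_box R d = \bigcap_(i in [set: 'I_d])
   ((fun t : d.-tuple (measurableTypeR R) => tnth t i) @^-1` circle)).
  apply: fin_bigcap_measurable => // i _.
  by rewrite -[X in measurable X]setTI; apply: measurable_tnth => //; exact: measurable_circle.
by apply/seteqP; split=> t /= H i; [move=> _; exact: H|exact: H].
Qed.

Lemma cons_torus_box d :
  @Defs.cons_tuple R d @^-1` (@torus_box R d.+1) =
  circle `*` @torus_box R d.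
Proof.
apply/seteqP; split=> -[x t] /=.
  move=> H; split=> [|i] /=; first by have := H ord0; rewrite tnth0.
  by have := H (lift ord0 i); rewrite tnthS.
move=> [/= Hx Ht] i; case: (unliftP ord0 i) => [j ->|->]; first by rewrite tnthS; exact: Ht.
by rewrite tnth0.
Qed.

Lemma torus_box_measure d : lebesgue_tuple R d (@torus_box R d) = ((2 * pi) ^+ d)%:E.
Proof.
elim: d => [|d IH].
  rewrite /= diracE mem_set ?expr0 //.
  by move=> [].
rewrite /= /lebesgue_cons /pushforward cons_torus_box product_measure1E //.
- by rewrite [X in (X * _)%E]circle_measure IH -EFinM exprS.
- exact: measurable_circle.
- exact: measurable_torus_box.
Qed.

Lemma torus_box_finite_measure d : (lebesgue_tuple R d (@torus_box R d) < +oo)%E.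
Proof. by rewrite torus_box_measure ltry. Qed.

Definition tpairing d (m : 'I_d -> int) (t : d.-tuple (measurableTypeR R)) : R :=
  \sum_(i < d) (m i)%:~R * tnth t i.

Lemma measurable_tpairing d (m : 'I_d -> int) : measurable_fun setT (tpairing m).
Proof.
apply: measurable_sum => i; apply: measurable_funM; first exact: measurable_cst.
exact: measurable_tnth.
Qed.

Lemma measurable_cos_tpairing d (a : R) (m : 'I_d -> int) :
  measurable_fun setT (fun t => cos (a + tpairing m t)).
Proof.
apply: measurableT_comp; first exact: continuous_measurable_fun (@continuous_cos R).
by apply: measurable_funD; [exact: measurable_cst|exact: measurable_tpairing].
Qed.

Lemma integrable_torus_bounded d (f : d.-tuple (measurableTypeR R) -> R) (B : R) :
  measurable_fun (@torus_box R d) f -> (forall t, @torus_box R d t -> `|f t| <= B) ->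
  (lebesgue_tuple R d).-integrable (@torus_box R d) (EFin \o f).
Proof.
move=> mf fB; apply: measurable_bounded_integrable => //.
- exact: measurable_torus_box.
- exact: torus_box_finite_measure.
exists B; split; first exact: num_real.
by move=> M BM t /= /fB /le_trans; apply; exact: ltW.
Qed.

Lemma integral_cos_torus d (a : R) (m : 'I_d -> int) :
  (\int[lebesgue_tuple R d]_(t in @torus_box R d) (cos (a + tpairing m t))%:E =
  (if [forall i, m i == 0] then (2 * pi) ^+ d * cos a else 0)%:E)%E.
Proof.
elim: d a m => [|d IH] a m.
  rewrite (_ : [forall i, _] = true); last by apply/forallP => -[].
  rewrite expr0 mul1r /= integral_dirac //=; last first.
  - by apply: measurableT_comp => //; apply: measurable_funTS; exact: measurable_cos_tpairing.
  - exact: measurable_torus_box.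
  by rewrite diracE mem_set ?mul1e; [rewrite /tpairing big_ord0 addr0|move=> []].
have mA := measurable_circle; have mB := @measurable_torus_box d.
pose m' i := m (lift ord0 i).
have tE x (s : d.-tuple (measurableTypeR R)) :
  tpairing m (Defs.cons_tuple (x, s)) = (m ord0)%:~R * x + tpairing m' s.
  by rewrite /tpairing big_ord_recl tnth0; congr (_ + _); apply: eq_bigr => i _; rewrite tnthS.
pose h (p : measurableTypeR R * d.-tuple (measurableTypeR R)) : \bar R :=
  (cos (a + tpairing m (Defs.cons_tuple p)))%:E.
have mh : measurable_fun setT h.
  apply/measurable_EFinP; apply: (measurableT_comp (measurable_cos_tpairing a m)).
  exact: measurable_cons_tuple.
have ih : (leb \x lebesgue_tuple R d)%E.-integrable (circle `*` @torus_box R d) h.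
  apply: measurable_bounded_integrable.
  - exact: measurableX.
  - by rewrite -cons_torus_box; exact: (torus_box_finite_measure d.+1).
  - by apply: measurable_funTS; apply/measurable_EFinP.
  exists 1; split=> // M M1 p _ /=; apply: le_trans (ltW M1).
  by rewrite ler_norml cos_geN1 cos_le1.
rewrite [LHS](_ : _ = \int[pushforward (leb \x lebesgue_tuple R d)%E (@Defs.cons_tuple R d)]_(t in @torus_box R d.+1)
   (cos (a + tpairing m t))%:E)%E //.
have mf : measurable_fun setT (EFin \o fun t => cos (a + tpairing m t)).
  by apply/measurable_EFinP; exact: measurable_cos_tpairing.
rewrite (integral_pushforward (@measurable_cons_tuple R d) mf); last 2 first.
- by rewrite cons_torus_box.
- exact: measurable_torus_box.
rewrite cons_torus_box -/h integral_mkcond.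
rewrite -integral12_prod_meas1; last first.
  by rewrite -integrable_mkcond //; exact: measurableX.
rewrite (_ : fubini_F _ _ =
   (fun x => (if [forall i, m' i == 0] then (2 * pi) ^+ d * cos (a + (m ord0)%:~R * x) else 0)%:E) \_ circle).
  rewrite -integral_mkcond.
  have -> : [forall i, m i == 0] = (m ord0 == 0) && [forall i, m' i == 0].
    apply/forallP/andP => [mi|[m0 /forallP mi] i].
      by split; [exact: mi|apply/forallP => i; exact: mi].
    by case: (unliftP ord0 i) => [j ->|->]; [exact: mi|].
  rewrite andbC; case: [forall i, m' i == 0] => /=; last by rewrite integral0.
  under eq_integral do rewrite EFinM.
  rewrite integralZl //=; last first.
  - apply: measurable_bounded_integrable => //.
    + by rewrite [X in (X < _)%E]circle_measure ltry.
    + apply: measurable_funTS; apply: measurableT_comp.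
        exact: continuous_measurable_fun (@continuous_cos R).
      by apply: measurable_funD => //; apply: measurable_funM.
    exists 1; split=> // M M1 p _ /=; apply: le_trans (ltW M1).
    by rewrite ler_norml cos_geN1 cos_le1.
  rewrite integral_cos_circle -EFinM; case: ifP => _; last by rewrite mulr0.
  by rewrite mulrA -exprSr.
apply/funext => x; rewrite /fubini_F patchE.
have -> : (fun y => (h \_ (circle `*` torus_box (d:=d))) (x, y)) =
   (if x \in circle then (fun y => h (x, y)) \_ (torus_box (d:=d)) else cst 0)%E.
  apply/funext => y; rewrite !patchE in_setX /=.
  by case: (x \in circle) => //=; rewrite /patch; case: (y \in _).
case: ifPn => _; last by rewrite integral0.
rewrite -integral_mkcond -(IH (a + (m ord0)%:~R * x) m').
by apply: eq_integral => y _; rewrite /h tE addrA.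
Qed.

End torus_integrals.

Section torus_mean.
Variables (R : realType) (d : nat).
Notation mu := (lebesgue_tuple R d).
Notation box := (@torus_box R d).

Definition kvec (t : d.-tuple (measurableTypeR R)) : 'rV[R]_d := \row_i tnth t i.

Lemma pairing_kvec (m : 'rV[int]_d) t : pairing m (kvec t) = tpairing (fun i => m 0 i) t.
Proof. by apply: eq_bigr => i _; rewrite mxE. Qed.

Lemma measurable_cos_pairing (m : 'rV[int]_d) :
  measurable_fun setT (fun t => cos (pairing m (kvec t))).
Proof.
have := @measurable_cos_tpairing R d 0 (fun i => m 0 i).
by apply: eq_measurable_fun => t _; rewrite pairing_kvec add0r.
Qed.

Lemma measurable_trig_sum (I : finType) (P : pred I) (w : I -> R) (m : I -> 'rV[int]_d) :
  measurable_fun setT (fun t => \sum_(i | P i) w i * cos (pairing (m i) (kvec t))).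
Proof.
have : measurable_fun setT (fun t => \sum_(i <- enum P) w i * cos (pairing (m i) (kvec t))).
  apply: measurable_sum => i; apply: measurable_funM; first exact: measurable_cst.
  exact: measurable_cos_pairing.
by apply: eq_measurable_fun => t _; rewrite big_enum.
Qed.

Lemma Rintegral_torus_sum (I : eqType) (r : seq I) (c : I -> R)
    (g : I -> d.-tuple (measurableTypeR R) -> R) :
  (forall i, mu.-integrable box (EFin \o g i)) ->
  mu.-integrable box (EFin \o fun t => \sum_(i <- r) c i * g i t) /\
  \int[mu]_(t in box) (\sum_(i <- r) c i * g i t) =
  \sum_(i <- r) c i * \int[mu]_(t in box) g i t.
Proof.
move=> ig; have mB := @measurable_torus_box R d.
elim: r => [|i r [IHi IH]].
  rewrite (_ : (fun t => _) = cst 0); last by apply/funext => t; rewrite big_nil.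
  rewrite big_nil Rintegral_cst // mul0r; split=> //.
  by apply: (@integrable_torus_bounded _ _ _ 0) => [|t _]; rewrite ?normr0.
have iZ : mu.-integrable box (EFin \o fun t => c i * g i t).
  by have := integrableZl mB (c i) (ig i).
have -> : (fun t => \sum_(j <- i :: r) c j * g j t) =
   (fun t => c i * g i t + \sum_(j <- r) c j * g j t).
  by apply/funext => t; rewrite big_cons.
split; first by have := integrableD mB iZ IHi.
by rewrite RintegralD // IH big_cons RintegralZl.
Qed.

Lemma Rintegral_cos_pairing (m : 'rV[int]_d) :
  \int[mu]_(t in box) cos (pairing m (kvec t)) = (2 * pi) ^+ d * (m == 0)%:R.
Proof.
rewrite /Rintegral (eq_integral (fun t => (cos (0 + tpairing (fun i => m 0 i) t))%:E)).
  rewrite integral_cos_torus cos0 mulr1 (_ : [forall i, _] = (m == 0)) /=.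
    by case: (m == 0); rewrite ?mulr1 ?mulr0.
  apply/forallP/eqP => [mi|-> i]; last by rewrite mxE.
  by apply/rowP => i; rewrite mxE; apply/eqP; exact: mi.
by move=> t _; rewrite add0r pairing_kvec.
Qed.

Lemma integrable_cos_pairing (m : 'rV[int]_d) :
  mu.-integrable box (EFin \o fun t => cos (pairing m (kvec t))).
Proof.
apply: (@integrable_torus_bounded _ _ _ 1) => [|t _].
  by apply: measurable_funTS; exact: measurable_cos_pairing.
by rewrite ler_norml cos_geN1 cos_le1.
Qed.

Lemma Rintegral_trig_sum (I : finType) (P : pred I) (w : I -> R) (m : I -> 'rV[int]_d) :
  \int[mu]_(t in box) (\sum_(i | P i) w i * cos (pairing (m i) (kvec t))) =
  (2 * pi) ^+ d * \sum_(i | P i && (m i == 0)) w i.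
Proof.
have := @Rintegral_torus_sum I (enum P) w (fun i t => cos (pairing (m i) (kvec t))).
move=> /(_ (fun i => integrable_cos_pairing (m i)))[_].
under eq_Rintegral do rewrite big_enum.
move=> ->; rewrite big_enum /= big_mkcondr mulr_sumr; apply: eq_bigr => i _.
rewrite Rintegral_cos_pairing mulrCA.
by case: eqP; rewrite ?mulr1 ?mulr0.
Qed.

Lemma ler_norm_torus_Rintegral (g : d.-tuple (measurableTypeR R) -> R) (B : R) :
  measurable_fun box g -> (forall t, box t -> `|g t| <= B) ->
  `|\int[mu]_(t in box) g t| <= (2 * pi) ^+ d * B.
Proof.
move=> mg gB; have mB := @measurable_torus_box R d.
have ig := integrable_torus_bounded mg gB.
apply: le_trans (le_normr_Rintegral mB ig) _.
have -> : (2 * pi) ^+ d * B = \int[mu]_(t in box) B.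
  by rewrite Rintegral_cst // [X in fine X]torus_box_measure mulrC.
apply: le_Rintegral => //; first exact: integrable_norm.
by apply: (@integrable_torus_bounded _ _ _ `|B|).
Qed.

Lemma cvg_torus_Rintegral (g_ : nat -> d.-tuple (measurableTypeR R) -> R) g (B : R) :
  (forall n, measurable_fun box (g_ n)) ->
  (forall n t, box t -> `|g_ n t| <= B) ->
  (forall t, box t -> g_ n t @[n --> \oo] --> g t) ->
  \int[mu]_(t in box) g_ n t @[n --> \oo] --> \int[mu]_(t in box) g t.
Proof.
move=> mg gB gg; have mB := @measurable_torus_box R d.
have mlim : measurable_fun box g.
  apply: (@measurable_fun_cvg _ _ _ _ g_) => // t bt; exact: gg.
have ifin (h : d.-tuple (measurableTypeR R) -> R) : mu.-integrable box (EFin \o h) ->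
    (\int[mu]_(t in box) (h t)%:E)%E = (\int[mu]_(t in box) h t)%:E.
  by move=> ih; rewrite /Rintegral fineK //; exact: integrable_fin_num.
have iB : mu.-integrable box (EFin \o cst B).
  by apply: (@integrable_torus_bounded _ _ _ `|B|).
have ig : mu.-integrable box (EFin \o g).
  apply: (@integrable_torus_bounded _ _ _ B) => // t bt.
  apply: (cvgr_to_le (cvg_norm (gg t bt))); apply: nearW => n; exact: gB.
apply: fine_cvg; rewrite -[X in _ --> X]ifin //.
apply: (@dominated_cvg _ _ _ mu box mB (fun n => EFin \o g_ n) (EFin \o g) (EFin \o cst B)).
- by move=> n; apply/measurable_EFinP.
- by move=> t bt; apply: cvg_EFin; [exact: nearW|exact: gg].
- by [].
- exact: iB.
- by move=> n t bt; rewrite lee_fin; exact: gB.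
Qed.

Lemma torus_int_sum (c : nat -> Cx R) (g : nat -> 'rV[R]_d -> R) N :
  (forall n, mu.-integrable box (EFin \o (g n \o kvec))) ->
  torus_int (fun k => \sum_(0 <= n < N) c n * toC (g n k)) =
  \sum_(0 <= n < N) c n * toC (\int[mu]_(t in box) g n (kvec t)).
Proof.
move=> ig.
have [_ HRe] := Rintegral_torus_sum (index_iota 0 N) (fun n => complex.Re (c n : R[i])) ig.
have [_ HIm] := Rintegral_torus_sum (index_iota 0 N) (fun n => complex.Im (c n : R[i])) ig.
rewrite /torus_int.
apply/eqP; rewrite eq_complex /= Re_sum Im_sum; apply/andP; split; apply/eqP.
  rewrite [RHS](eq_bigr (fun n => complex.Re (c n : R[i]) * \int[mu]_(t in box) g n (kvec t))).
    rewrite -HRe; apply: eq_Rintegral => t _; rewrite Re_sum; apply: eq_bigr => n _.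
    by rewrite mulrC Re_toCM mulrC.
  by move=> n _; rewrite mulrC Re_toCM mulrC.
rewrite [RHS](eq_bigr (fun n => complex.Im (c n : R[i]) * \int[mu]_(t in box) g n (kvec t))).
  rewrite -HIm; apply: eq_Rintegral => t _; rewrite Im_sum; apply: eq_bigr => n _.
  by rewrite mulrC Im_toCM mulrC.
by move=> n _; rewrite mulrC Im_toCM mulrC.
Qed.

Lemma cvg_torus_int (F_ : nat -> 'rV[R]_d -> Cx R) (F : 'rV[R]_d -> Cx R) (B : R) :
  (forall n, measurable_fun box (fun t => complex.Re (F_ n (kvec t) : R[i]))) ->
  (forall n, measurable_fun box (fun t => complex.Im (F_ n (kvec t) : R[i]))) ->
  (forall n k, cabs (F_ n k) <= B) ->
  (forall k, F_ n k @[n --> \oo] --> F k) ->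
  torus_int (F_ n) @[n --> \oo] --> torus_int F.
Proof.
move=> mRe mIm FB FF; apply: cvg_ReIm.
  apply: (@cvg_torus_Rintegral (fun n t => complex.Re (F_ n (kvec t) : R[i])) _ B) => //.
    by move=> n t _; apply: le_trans (FB n (kvec t)); exact: ler_absRe_cabs.
  by move=> t _; apply: cvg_Re; exact: FF.
apply: (@cvg_torus_Rintegral (fun n t => complex.Im (F_ n (kvec t) : R[i])) _ B) => //.
  by move=> n t _; apply: le_trans (FB n (kvec t)); exact: ler_absIm_cabs.
by move=> t _; apply: cvg_Im; exact: FF.
Qed.

End torus_mean.

Section double_series.
Variable R : realType.

Lemma ler_sum_support (I : eqType) (F : I -> R) (J S : seq I) :
  uniq J -> uniq S -> (forall i, 0 <= F i) -> (forall i, i \notin S -> F i = 0) ->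
  \sum_(i <- J) F i <= \sum_(i <- S) F i.
Proof.
move=> uJ uS F0 FS; rewrite (bigID (mem S)) /= [X in _ + X]big1 => [|i /FS //].
rewrite addr0 -big_filter.
rewrite (perm_big [seq i <- S | i \in J]) /=.
  by rewrite big_filter [leRHS](bigID (mem J)) /= lerDl sumr_ge0.
apply: uniq_perm; rewrite ?filter_uniq // => i.
by rewrite !mem_filter andbC.
Qed.

Lemma eq_sum_support (I : eqType) (V : nmodType) (F : I -> V) (J S : seq I) :
  uniq J -> uniq S -> {subset S <= J} -> (forall i, i \notin S -> F i = 0) ->
  \sum_(i <- J) F i = \sum_(i <- S) F i.
Proof.
move=> uJ uS SJ FS; rewrite (bigID (mem S)) /= [X in _ + X]big1 => [|i /FS //].
rewrite addr0 -big_filter; apply: perm_big; apply: uniq_perm; rewrite ?filter_uniq // => i.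
by rewrite mem_filter andb_idr // => /SJ.
Qed.

Lemma ler_dist_cabs (z w : Cx R) : `|cabs z - cabs w| <= cabs (z - w).
Proof.
have h1 : cabs w <= cabs z + cabs (z - w) by rewrite -{1}(subKr z w) ler_cabsB.
have h2 : cabs z <= cabs (z - w) + cabs w by rewrite -{1}(subrK w z) ler_cabsD.
by rewrite ler_norml; apply/andP; split; lra.
Qed.

Lemma toC_sum (I : Type) (r : seq I) (F : I -> R) :
  toC (\sum_(i <- r) F i) = \sum_(i <- r) toC (F i).
Proof. exact: rmorph_sum. Qed.

Lemma cvg_cabs_le (u : nat -> Cx R) L N e :
  u @ \oo --> L -> (forall n, (N <= n)%N -> cabs (u n) <= e) -> cabs L <= e.
Proof.
move=> /cvg_cabsP uL ue.
have : cabs (u n - L) + e @[n --> \oo] --> 0 + e by apply: cvgD uL (cvg_cst _).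
rewrite add0r => H; apply: (cvgr_to_ge H); near=> n.
have -> : L = - (u n - L) + u n by rewrite opprB subrK.
apply: le_trans (ler_cabsD _ _) _; rewrite cabsN opprD opprK addrCA subrr addr0.
by rewrite lerD2l; apply: ue; near: n; exists N.
Unshelve. all: by end_near. Qed.

Lemma cvg_cabsD (u v : nat -> Cx R) (L M : Cx R) :
  u @ \oo --> L -> v @ \oo --> M -> u n + v n @[n --> \oo] --> L + M.
Proof.
move=> /cvg_cabsP uL /cvg_cabsP vM.
apply: (@cvg_cabs_squeeze _ _ _ (fun n => cabs (u n - L) + cabs (v n - M))) => [n|].
  by rewrite opprD addrACA; exact: ler_cabsD.
by rewrite -[0]addr0; exact: (cvgD uL vM).
Qed.

Lemma cvg_cabsMl (c : Cx R) (u : nat -> Cx R) (L : Cx R) :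
  u @ \oo --> L -> c * u n @[n --> \oo] --> c * L.
Proof.
move=> /cvg_cabsP uL.
apply: (@cvg_cabs_squeeze _ _ _ (fun n => cabs c * cabs (u n - L))) => [n|].
  by rewrite -mulrBr cabsM.
by rewrite -[X in _ --> X](mulr0 (cabs c)); exact: (cvgM (cvg_cst _) uL).
Qed.

Lemma cvg_cabsN (u : nat -> Cx R) (L : Cx R) :
  u @ \oo --> L -> - u n @[n --> \oo] --> - L.
Proof.
move=> uL; rewrite -mulN1r (_ : (fun n => _) = (fun n => -1 * u n)).
  exact: cvg_cabsMl.
by apply/funext => n; rewrite mulN1r.
Qed.

Lemma cvg_seq_sum (I : Type) (r : seq I) (f : I -> nat -> Cx R) (l : I -> Cx R) :
  (forall i, f i @ \oo --> l i) ->
  (fun n => \sum_(i <- r) f i n) @ \oo --> \sum_(i <- r) l i.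
Proof.
move=> fl; apply/cvg_cabsP.
apply: (squeeze_cvgr (f := cst 0) (h := fun n => \sum_(i <- r) cabs (f i n - l i))).
- by apply: nearW => n; rewrite cabs_ge0 -sumrB ler_cabs_sum.
- exact: cvg_cst.
elim: r => [|i r IH].
  by under eq_fun do rewrite big_nil; exact: cvg_cst.
rewrite (_ : (fun n => _) =
    (fun n => cabs (f i n - l i) + \sum_(j <- r) cabs (f j n - l j))); last first.
  by apply/funext => n; rewrite big_cons.
rewrite -[X in _ --> X]addr0; apply: cvgD; last exact: IH.
by apply/cvg_cabsP; exact: fl.
Qed.

Variables (I : choiceType) (a : nat -> I -> Cx R) (B : nat -> {fset I}) (b : nat -> R).
Hypothesis a0 : forall n i, (0 < n)%N -> i \notin B n -> a n i = 0.
Hypothesis ab : forall n, (0 < n)%N -> \sum_(i <- B n) cabs (a n i) <= b n.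
Hypothesis cb : cvgn (fun N => \sum_(1 <= n < N) b n).

Let b_ge0 n : (0 < n)%N -> 0 <= b n.
Proof. by move=> n0; apply: le_trans (ab n0); apply: sumr_ge0 => i _; exact: cabs_ge0. Qed.

Let sum_b_le M N : (M <= N)%N -> \sum_(1 <= n < M) b n <= \sum_(1 <= n < N) b n.
Proof.
move=> MN; case: (leqP 1 M) => [M1|]; last first.
  rewrite ltnS leqn0 => /eqP ->; rewrite big_geq // big_nat sumr_ge0 // => n /andP[n1 _].
  exact: b_ge0.
rewrite [leRHS](big_cat_nat _ MN) //= lerDl big_nat sumr_ge0 // => n /andP[Mn _].
by apply: b_ge0; exact: leq_trans Mn.
Qed.

Let lim_b_ge N : \sum_(1 <= n < N) b n <= limn (fun N => \sum_(1 <= n < N) b n).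
Proof.
by apply: limr_ge => //; exists N => // n /= Nn; exact: sum_b_le.
Qed.

Let sum_a_le (J : seq I) n : uniq J -> (0 < n)%N -> \sum_(i <- J) cabs (a n i) <= b n.
Proof.
move=> uJ n0; apply: le_trans (ab n0).
apply: ler_sum_support => // [i|i /(a0 n0) ->]; [exact: cabs_ge0|exact: cabs0].
Qed.

Lemma double_series_cvg i : abs_cvg1 (a ^~ i).
Proof.
apply: le_abs_cvg1 cb => n n0.
by have := @sum_a_le [:: i] n isT n0; rewrite big_seq1.
Qed.

Lemma double_series_summable : abs_summable (fun i => csum1 (a ^~ i)).
Proof.
apply: (@le_lt_trans _ _ (limn (fun N => \sum_(1 <= n < N) b n))%:E); last by rewrite ltry.
apply: ge_ereal_sup => _ [X [finX _] <-]; rewrite fsbig_finite // sumEFin lee_fin.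
set J := fset_set X.
have H : \sum_(i <- J) toC (cabs (\sum_(1 <= n < N) a n i)) @[N --> \oo]
     --> \sum_(i <- J) toC (cabs (csum1 (a ^~ i))).
  apply: cvg_seq_sum => i; have /cvg_cabsP := abs_cvg1_cvg (@double_series_cvg i).
  apply: cvg_cabs_squeeze => N.
  by rewrite -rmorphB cabs_toC; exact: ler_dist_cabs.
have := cvg_cabs_le (N := 0) (e := limn (fun N => \sum_(1 <= n < N) b n)) H.
rewrite -toC_sum cabs_toC ger0_norm; last by apply: sumr_ge0 => i _; exact: cabs_ge0.
apply=> N _; rewrite -toC_sum cabs_toC ger0_norm; last first.
  by apply: sumr_ge0 => i _; exact: cabs_ge0.
apply: le_trans (lim_b_ge N).
apply: (@le_trans _ _ (\sum_(i <- J) \sum_(1 <= n < N) cabs (a n i))).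
  by apply: ler_sum => i _; exact: ler_cabs_sum.
rewrite exchange_big /= !big_nat; apply: ler_sum => n /andP[n0 _].
exact: sum_a_le.
Qed.

Lemma double_series_sum :
  abs_cvg1 (fun n => \sum_(i <- B n) a n i) /\
  csum (fun i => csum1 (a ^~ i)) = csum1 (fun n => \sum_(i <- B n) a n i).
Proof.
set s := (fun n => _).
have sb n : (0 < n)%N -> cabs (s n) <= b n.
  by move=> n0; apply: le_trans (ler_cabs_sum _ _ _) _; exact: ab.
have cs : abs_cvg1 s by exact: le_abs_cvg1 cb.
split=> //; apply: cvg_lim; [exact: norm_hausdorff|exact: totally_filter|].
apply: (@cvg_cabs R _ totally totally_filter) => e e0.
set M := limn (fun N => \sum_(1 <= n < N) b n).
have [N0 _ HN0] : \forall N \near \oo, M - \sum_(1 <= n < N) b n < e / 2.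
  have /cvgrPdist_lt/(_ (e / 2)) := cb; rewrite divr_gt0 // => /(_ isT).
  by apply: filterS => N; apply: le_lt_trans; exact: ler_norm.
set N := maxn 1 N0.
have {HN0} HN : M - \sum_(1 <= n < N) b n < e / 2 by apply: HN0; rewrite /= leq_maxr.
have N1 : (0 < N)%N by rewrite leq_max.
exists (\bigcup_(n <- iota 1 N) B n)%fset => // J /= AJ.
suff : cabs (\sum_(i <- J) csum1 (a ^~ i) - csum1 s) < e by rewrite big_seq_fsetE.
have BJ n : (0 < n < N)%N -> {subset B n <= J}.
  move=> /andP[n0 nN] i iB; apply: (fsubsetP AJ); apply/bigfcupP; exists n => //.
  by rewrite mem_iota n0 add1n ltnS ltnW.
have H : \sum_(i <- J) (\sum_(1 <= n < N') a n i) - \sum_(1 <= n < N') s n @[N' --> \oo]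
     --> \sum_(i <- J) csum1 (a ^~ i) - csum1 s.
  apply: cvg_cabsD; last by apply: cvg_cabsN; exact: abs_cvg1_cvg.
  by apply: cvg_seq_sum => i; apply: abs_cvg1_cvg; exact: (@double_series_cvg i).
apply: (@le_lt_trans _ _ (2 * (M - \sum_(1 <= n < N) b n))); last first.
  by rewrite mulrC -ltr_pdivlMr.
apply: (cvg_cabs_le (N := N) H) => N' NN'.
rewrite exchange_big /= -sumrB (big_cat_nat _ NN') //= big1_seq ?add0r; last first.
  move=> n; rewrite mem_index_iota => /andP[_ nN].
  rewrite (@eq_sum_support _ _ _ J (B n)) ?subrr //; first exact: BJ.
  by move=> i; apply: a0; case/andP: nN.
apply: le_trans (ler_cabs_sum _ _ _) _.
apply: (@le_trans _ _ (\sum_(N <= n < N') 2 * b n)).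
  rewrite !big_nat; apply: ler_sum => n /andP[Nn _].
  have n0 : (0 < n)%N by exact: leq_trans Nn.
  rewrite mulr_natl mulr2n; apply: le_trans (ler_cabsB _ _) _; apply: lerD (sb _ n0).
  by apply: le_trans (ler_cabs_sum _ _ _) _; exact: sum_a_le.
rewrite -mulr_sumr ler_pM2l // lerBrDr addrC -big_cat_nat //; exact: lim_b_ge.
Qed.

End double_series.

Section polynomial_geometric.
Variable R : realType.

Lemma bernoulli_ge (x : R) n : 0 <= x <= 1 -> 1 - n%:R * x <= (1 - x) ^+ n.
Proof.
move=> /andP[x0 x1]; elim: n => [|n IH]; first by rewrite mul0r subr0 expr0.
rewrite exprS -natr1.
have : (1 - x) * (1 - n%:R * x) <= (1 - x) * (1 - x) ^+ n by rewrite ler_wpM2l ?subr_ge0.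
have : 0 <= n%:R * x * x by rewrite !mulr_ge0.
by nra.
Qed.

Lemma bernoulli_le (x : R) n : 0 <= x <= 1 -> (1 + n%:R * x) * (1 - x) ^+ n <= 1.
Proof.
move=> /andP[x0 x1]; elim: n => [|n IH]; first by rewrite mul0r addr0 expr0 mul1r.
apply: le_trans IH; rewrite exprS mulrA ler_wpM2r ?exprn_ge0 ?subr_ge0 // -natr1.
have : 0 <= n%:R * x * x by rewrite !mulr_ge0.
by nra.
Qed.

Lemma polynomial_geometric_bound (A : R) (d : nat) (q : R) : 0 <= A -> 0 <= q < 1 ->
  exists C s : R, [/\ 0 <= C, 0 <= s < 1 & forall n, (A * n%:R + 1) ^+ d * q ^+ n <= C * s ^+ n].
Proof.
move=> A0 /andP[q0 q1].
pose x : R := (1 - q) / d.+1%:R.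
have x0 : 0 < x by rewrite divr_gt0 // subr_gt0.
have x1 : x <= 1.
  by rewrite ler_pdivrMr // mul1r; apply: (@le_trans _ _ 1); [lra|rewrite ler1n].
pose s := 1 - x.
have s0 : 0 <= s by rewrite subr_ge0.
have qs : q <= s ^+ d.+1.
  apply: le_trans (bernoulli_ge d.+1 _); last by rewrite ltW.
  by rewrite mulrC divfK ?pnatr_eq0 // subKr.
have C0 : 0 <= A / x + 1 by rewrite addr_ge0 // divr_ge0 // ltW.
exists ((A / x + 1) ^+ d), s; split=> [||n].
- exact: exprn_ge0.
- by rewrite s0 /s ltrBlDr ltrDl.
have sn0 : 0 <= s ^+ n by exact: exprn_ge0.
have P0 : 0 <= A * n%:R + 1 by rewrite addr_ge0 // mulr_ge0.
apply: (@le_trans _ _ ((A * n%:R + 1) ^+ d * (s ^+ d.+1) ^+ n)).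
  by rewrite ler_wpM2l ?exprn_ge0 // lerXn2r ?nnegrE ?exprn_ge0.
rewrite -exprM mulnC exprM exprS mulrCA -exprMn mulrC ler_wpM2r //.
rewrite lerXn2r ?nnegrE // ?mulr_ge0 // mulrDl mul1r lerD //.
  have := @bernoulli_le x n; rewrite ltW // x1 => /(_ isT).
  rewrite -/s mulrDl mul1r => H.
  rewrite ler_pdivlMr // -!mulrA ler_piMr //.
  rewrite (mulrC _ x) mulrA; apply: le_trans H; by rewrite lerDr.
by rewrite exprn_ile1 // /s lerBlDr lerDl ltW.
Qed.

Lemma cvg_sum1_geometric (C s : R) : 0 <= s < 1 ->
  cvgn (fun N => \sum_(1 <= n < N) C * s ^+ n).
Proof.
move=> /andP[s0 s1].
have := @is_cvg_geometric_series R C s; rewrite ger0_norm // => /(_ s1).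
by rewrite -(is_cvg_series_restrict 1).
Qed.

End polynomial_geometric.

Lemma opnorm_ge0 (R : realType) (X : choiceType) (T : (X -> Cx R) -> (X -> Cx R)) :
  (0 <= opnorm T)%E.
Proof.
apply: (@le_trans _ _ (l2norm (T (fun=> 0)))); first exact: sqrte_ge0.
apply: ereal_sup_ubound; exists (fun=> 0) => //=.
rewrite /l2norm esum1 ?sqrte0 ?lee01 // => x _.
by rewrite cabs0 expr0n.
Qed.

Lemma ler_sum_ord (R : realType) n (F : 'I_n -> R) (x : R) :
  (forall i, F i <= x) -> \sum_i F i <= n%:R * x.
Proof.
move=> Fx; apply: (@le_trans _ _ (\sum_(i < n) x)); first exact: ler_sum.
by rewrite sumr_const card_ord mulr_natl.
Qed.

Lemma csum1_of_series (R : realType) (u v : nat -> Cx R) (L : Cx R) :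
  (forall n, (0 < n)%N -> v n = - u n) ->
  (fun N => \sum_(0 <= n < N) v n) @ \oo --> L -> csum1 u = v 0%N - L.
Proof.
move=> vu /cvg_cabsP H; apply: csum1_eq; apply/cvg_cabsP.
rewrite -(cvg_shiftS (fun N => cabs (\sum_(1 <= n < N) u n - (v 0%N - L)))).
rewrite (_ : (fun N => _) = (fun N => cabs (\sum_(0 <= n < N.+1) v n - L))).
  by rewrite (cvg_shiftS (fun N => cabs (\sum_(0 <= n < N) v n - L))).
apply/funext => N; rewrite big_add1 /= -[RHS]cabsN big_nat_recl //.
rewrite !opprD !opprK addrA -sumrN; congr (cabs (_ + _)); rewrite addrC; congr (_ + _).
by apply: eq_bigr => n _; rewrite vu // opprK.
Qed.

Section expansions.
Variables (R : realType) (d : nat) (G : periodic_graph R d) (V : vert G -> R).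
Notation nu := #|qvert G|.
Implicit Types (k : 'rV[R]_d) (l : Cx R) (r : R).

Definition fiber_eigenvalue k : 'I_nu -> R := projT1 (cid (fiber_spectrum V k)).

Lemma sum_cycles_expi n k : (0 < n)%N ->
  \sum_(c : n.-tuple (medge G) | is_cycle c) toC (weight V c) * expi (pairing (ctau c) k) =
  toC (\sum_i fiber_eigenvalue k i ^+ n).
Proof. by move=> n0; case: (projT2 (cid (fiber_spectrum V k))) => /(_ n n0). Qed.

Lemma fiber_eigenvector k i : exists g : qvert G -> Cx R,
  (exists X, g X != 0) /\ (forall X, fiber V k g X = toC (fiber_eigenvalue k i) * g X).
Proof. by case: (projT2 (cid (fiber_spectrum V k))) => _ /(_ i). Qed.

Lemma fiber_resolvent k l : (forall i, toC (fiber_eigenvalue k i) != l) ->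
  opmx (fiber V k) - l%:M \in unitmx /\
  tr_resolvent (fiber V k) l = \sum_i (toC (fiber_eigenvalue k i) - l)^-1.
Proof. by case: (projT2 (cid (fiber_spectrum V k))) => _ _; exact. Qed.

Lemma TnE n k : (0 < n)%N -> Tn V n k = \sum_i fiber_eigenvalue k i ^+ n.
Proof.
move=> n0; have /(congr1 (fun z : Cx R => complex.Re (z : R[i]))) := sum_cycles_expi k n0.
rewrite Re_sum [RHS]/= => <-; apply: eq_bigr => c _; by rewrite Re_toCM.
Qed.

Lemma sum_cycles_sin n k : (0 < n)%N ->
  \sum_(c : n.-tuple (medge G) | is_cycle c) weight V c * sin (pairing (ctau c) k) = 0.
Proof.
move=> n0; have /(congr1 (fun z : Cx R => complex.Im (z : R[i]))) := sum_cycles_expi k n0.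
rewrite Im_sum [RHS]/= => H; rewrite -[RHS]H; apply: eq_bigr => c _; by rewrite Im_toCM.
Qed.

Lemma fiber_eigenvalue_le_opnorm k r i : 0 <= r -> (opnorm (fiber V k) <= r%:E)%E ->
  `|fiber_eigenvalue k i| <= r.
Proof.
move=> r0 Tr; have [g [g0 gE]] := fiber_eigenvector k i.
exact: (fiber_eigenvalue_bound g0 gE r0 Tr).
Qed.

Lemma fiber_eigenvalue_le_schroedinger k r i : periodic_potential V ->
  0 <= r -> (opnorm (schroedinger V) <= r%:E)%E -> `|fiber_eigenvalue k i| <= r.
Proof.
move=> hV r0 Tr; have [g [g0 gE]] := fiber_eigenvector k i.
exact: (schroedinger_eigenvalue_bound g0 gE hV r0 Tr).
Qed.

Lemma ler_norm_Tn n k r : (0 < n)%N -> (forall i, `|fiber_eigenvalue k i| <= r) ->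
  `|Tn V n k| <= nu%:R * r ^+ n.
Proof.
move=> n0 Dr; rewrite TnE //; apply: le_trans (ler_norm_sum _ _ _) _.
apply: ler_sum_ord => i.
by rewrite normrX lerXn2r ?nnegrE ?(le_trans _ (Dr i)) // normr_ge0.
Qed.

(* [Tn V 0] vanishes since cycles are nonempty, whereas Tr (H(k)^0) = nu. *)
Definition trace_pow n k : R := if n is 0 then nu%:R else Tn V n k.

Lemma trace_powE n k : trace_pow n k = \sum_i fiber_eigenvalue k i ^+ n.
Proof.
case: n => [|n] /=; last exact: TnE.
by under eq_bigr do rewrite expr0; rewrite sumr_const card_ord.
Qed.

Lemma ler_norm_trace_pow n k r : (forall i, `|fiber_eigenvalue k i| <= r) ->
  `|trace_pow n k| <= nu%:R * r ^+ n.
Proof.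
by case: n => [|n] Dr /=; [rewrite expr0 mulr1 ger0_norm|exact: ler_norm_Tn].
Qed.

Section resolvent_series.
Variables (k : 'rV[R]_d) (l : Cx R) (r : R).
Hypothesis r_ge0 : 0 <= r.
Hypothesis lt_rl : r < cabs l.
Hypothesis eig_le : forall i, `|fiber_eigenvalue k i| <= r.

Let l_neq0 : l != 0.
Proof. by rewrite -cabs_eq0 gt_eqF // (le_lt_trans r_ge0). Qed.

Let eig_neq i : toC (fiber_eigenvalue k i) != l.
Proof.
apply: contraTneq lt_rl => <-; rewrite cabs_toC -leNgt; exact: eig_le.
Qed.

Lemma fiber_resolvent_unit : opmx (fiber V k) - l%:M \in unitmx.
Proof. by have [] := fiber_resolvent eig_neq. Qed.

Lemma resolvent_remainder N :
  cabs (tr_resolvent (fiber V k) l + \sum_(0 <= n < N) toC (trace_pow n k) / l ^+ n.+1) <=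
  nu%:R / (cabs l - r) * (r / cabs l) ^+ N.
Proof.
have [_ ->] := fiber_resolvent eig_neq.
rewrite (_ : \sum_(0 <= n < N) _ =
  \sum_i \sum_(0 <= n < N) toC (fiber_eigenvalue k i) ^+ n / l ^+ n.+1); last first.
  rewrite exchange_big /=; apply: eq_bigr => n _.
  rewrite trace_powE toC_sum mulr_suml; apply: eq_bigr => i _.
  by rewrite rmorphXn.
rewrite -big_split /=; apply: le_trans (ler_cabs_sum _ _ _) _.
rewrite -!mulrA; apply: ler_sum_ord => i.
rewrite resolvent_geometric // cabsM cabsV cabsX cabsM cabsV cabs_toC mulrC.
apply: ler_pM.
- by rewrite invr_ge0 cabs_ge0.
- by rewrite exprn_ge0 // divr_ge0 // cabs_ge0.
- rewrite lef_pV2 ?posrE ?subr_gt0 //; last first.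
    by rewrite lt_neqAle eq_sym cabs_eq0 subr_eq0 eig_neq cabs_ge0.
  have := ler_dist_cabs l (toC (fiber_eigenvalue k i)); rewrite cabs_toC.
  rewrite -[cabs (l - _)]cabsN opprB => /(le_trans (ler_norm _)); apply: le_trans.
  by rewrite lerD2l lerN2.
rewrite lerXn2r ?nnegrE ?divr_ge0 ?cabs_ge0 //.
by rewrite ler_wpM2r ?invr_ge0 ?cabs_ge0.
Qed.

Let ratio_lt1 : 0 <= r / cabs l < 1.
Proof.
have l0 := le_lt_trans r_ge0 lt_rl.
by rewrite divr_ge0 ?cabs_ge0 //= ltr_pdivrMr // mul1r.
Qed.

Lemma resolvent_series_bound N :
  cabs (\sum_(0 <= n < N) (- (l ^+ n.+1)^-1) * toC (trace_pow n k)) <=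
  2 * (nu%:R / (cabs l - r)).
Proof.
have le_rem M : cabs (tr_resolvent (fiber V k) l +
    \sum_(0 <= n < M) toC (trace_pow n k) / l ^+ n.+1) <= nu%:R / (cabs l - r).
  apply: le_trans (resolvent_remainder M) _; rewrite ler_piMr //.
    by rewrite divr_ge0 // subr_ge0 ltW.
  by case/andP: ratio_lt1 => q0 q1; rewrite exprn_ile1 // ltW.
have := le_rem 0%N; rewrite big_geq // addr0 => le0.
rewrite (_ : \sum_(0 <= n < N) _ = tr_resolvent (fiber V k) l -
   (tr_resolvent (fiber V k) l + \sum_(0 <= n < N) toC (trace_pow n k) / l ^+ n.+1)).
  by rewrite mulr_natl mulr2n; apply: le_trans (ler_cabsB _ _) _; exact: lerD.
rewrite opprD addrA subrr sub0r -sumrN; apply: eq_bigr => n _.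
by rewrite mulNr mulrC.
Qed.

Lemma resolvent_series_cvg :
  \sum_(0 <= n < N) (- (l ^+ n.+1)^-1) * toC (trace_pow n k) @[N --> \oo] -->
  tr_resolvent (fiber V k) l.
Proof.
apply: (cvg_cabs_squeeze _ (geometric_cvg0 (nu%:R / (cabs l - r)) ratio_lt1)) => N.
rewrite -cabsN opprB; apply: le_trans (resolvent_remainder N).
rewrite le_eqVlt -sumrN; apply/orP; left; apply/eqP; congr (cabs (_ + _)).
by apply: eq_bigr => n _; rewrite mulNr opprK mulrC.
Qed.

Lemma abs_cvg1_le_geometric (T : nat -> R) :
  (forall n, (0 < n)%N -> `|T n| <= nu%:R * r ^+ n) ->
  abs_cvg1 (fun n => toC (T n) / l ^+ n.+1).
Proof.
move=> Tr; have l0 := le_lt_trans r_ge0 lt_rl.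
apply: (@le_abs_cvg1 _ _ (fun n => nu%:R / cabs l * (r / cabs l) ^+ n)) => [n n0|].
  rewrite cabsM cabs_toC cabsV cabsX exprS invfM exprMn exprVn.
  rewrite (_ : _ * _ * _ = nu%:R * r ^+ n * ((cabs l)^-1 * (cabs l ^+ n)^-1)); last by ring.
  rewrite ler_wpM2r ?Tr // mulr_ge0 ?invr_ge0 ?exprn_ge0 ?cabs_ge0 //.
exact: cvg_sum1_geometric.
Qed.

Lemma resolvent_expansion :
  abs_cvg1 (fun n => toC (Tn V n k) / l ^+ n.+1) /\
  tr_resolvent (fiber V k) l =
    - (nu%:R / l) - csum1 (fun n => toC (Tn V n k) / l ^+ n.+1).
Proof.
have ab : abs_cvg1 (fun n => toC (Tn V n k) / l ^+ n.+1).
  by apply: abs_cvg1_le_geometric => n n0; exact: ler_norm_Tn.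
split=> //; rewrite (csum1_of_series _ resolvent_series_cvg) => [|n n0].
  by rewrite /= rmorph_nat expr1; ring.
by case: n n0 => // n _; rewrite mulNr mulrC.
Qed.

End resolvent_series.

End expansions.

Lemma continuous_sum_seq (R : realType) (T : topologicalType) (I : Type) (r : seq I)
    (P : pred I) (f : I -> T -> R) :
  (forall i, continuous (f i)) -> continuous (fun x => \sum_(i <- r | P i) f i x).
Proof.
move=> cf; elim: r => [|i r IH].
  rewrite (_ : (fun x => _) = cst 0); first exact: cst_continuous.
  by apply/funext => x; rewrite big_nil.
rewrite (_ : (fun x => _) =
  (fun x => (if P i then f i x else 0) + \sum_(j <- r | P j) f j x)); last first.
  by apply/funext => x; rewrite big_cons; case: ifP; rewrite ?add0r.
move=> x; apply: continuousD; last exact: IH.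
by case: (P i); [exact: cf|exact: cst_continuous].
Qed.

Lemma cvg_seq_sum0 (R : realType) (I : Type) (r : seq I) (f : I -> nat -> R) :
  (forall i, f i @ \oo --> (0 : R)) -> \sum_(i <- r) f i n @[n --> \oo] --> (0 : R).
Proof.
move=> f0; elim: r => [|i r IH].
  rewrite (_ : (fun n => _) = cst 0); first exact: cvg_cst.
  by apply/funext => n; rewrite big_nil.
rewrite (_ : (fun n => _) = (fun n => f i n + \sum_(j <- r) f j n)); last first.
  by apply/funext => n; rewrite big_cons.
by rewrite -[X in _ --> X]addr0; apply: cvgD; [exact: f0|exact: IH].
Qed.

Section fourier.
Variables (R : realType) (d : nat) (G : periodic_graph R d) (V : vert G -> R).
Notation nu := #|qvert G|.
Notation mu := (lebesgue_tuple R d).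
Notation box := (@torus_box R d).

Lemma continuous_pairing (m : 'rV[int]_d) : continuous (fun k : 'rV[R]_d => pairing m k).
Proof.
apply: continuous_sum_seq => i k; apply: continuousM; first exact: cst_continuous.
exact: coord_continuous.
Qed.

Lemma continuous_trace_pow n : continuous (fun k : 'rV[R]_d => trace_pow V n k).
Proof.
case: n => [|n]; first exact: cst_continuous.
apply: continuous_sum_seq => c k; apply: continuousM; first exact: cst_continuous.
apply: continuous_comp; first exact: continuous_pairing.
exact: continuous_cos.
Qed.

Lemma measurable_trace_pow n : measurable_fun setT (fun t => trace_pow V n (kvec t)).
Proof.
case: n => [|n]; first exact: measurable_cst.
exact: (@measurable_trig_sum R d (n.+1.-tuple (medge G)) (fun c => is_cycle c)
   (fun c => weight V c) (fun c => ctau c)).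
Qed.

Lemma Rintegral_trace_pow n :
  \int[mu]_(t in box) trace_pow V n (kvec t) =
  (2 * pi) ^+ d * (if n is 0 then nu%:R else Tnm V n 0).
Proof.
case: n => [|n]; last first.
  exact: (@Rintegral_trig_sum R d (n.+1.-tuple (medge G)) (fun c => is_cycle c)
     (fun c => weight V c) (fun c => ctau c)).
rewrite /= Rintegral_cst; last exact: measurable_torus_box.
by rewrite [X in fine X]torus_box_measure mulrC.
Qed.

(* [Tnm V n m] is the Fourier coefficient of index m of [Tn V n]; the phase
   shift only brings in the sine sums, which vanish. *)
Lemma ler_norm_Tnm n (m : 'rV[int]_d) (r : R) : (0 < n)%N ->
  (forall t, box t -> forall i, `|fiber_eigenvalue V (kvec t) i| <= r) ->
  `|Tnm V n m| <= nu%:R * r ^+ n.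
Proof.
move=> n0 br.
have p0 : 0 < (2 * pi) ^+ d :> R by rewrite exprn_gt0 // mulr_gt0 // pi_gt0.
pose g t := \sum_(c : n.-tuple (medge G) | is_cycle c)
  weight V c * cos (pairing (ctau c - m) (kvec t)).
have gE t : g t = cos (pairing m (kvec t)) * Tn V n (kvec t).
  have s0 := sum_cycles_sin V (kvec t) n0.
  rewrite -[RHS]addr0 -(mulr0 (sin (pairing m (kvec t)))) -s0 /Tn !mulr_sumr -big_split /=.
  by apply: eq_bigr => c _; rewrite pairingD pairingN cosB; ring.
have intg : \int[mu]_(t in box) g t = (2 * pi) ^+ d * Tnm V n m.
  rewrite (@Rintegral_trig_sum R d (n.-tuple (medge G)) (fun c => is_cycle c)
     (fun c => weight V c) (fun c => ctau c - m)).
  by congr (_ * _); apply: eq_bigl => c; rewrite subr_eq0.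
rewrite -(ler_pM2l p0) -{1}(ger0_norm (ltW p0)) -normrM -intg.
apply: ler_norm_torus_Rintegral.
  apply: measurable_funTS.
  exact: (@measurable_trig_sum R d (n.-tuple (medge G)) (fun c => is_cycle c)
     (fun c => weight V c) (fun c => ctau c - m)).
move=> t bt; rewrite gE normrM; apply: le_trans (ler_norm_Tn n0 (br t bt)).
rewrite ler_piMl // ler_norml; by rewrite cos_geN1 cos_le1.
Qed.

Lemma ctau_bound : exists D : nat, forall (c : seq (medge G)) (s : 'I_d),
  (absz (ctau c 0%R s) <= size c * D)%N.
Proof.
pose D := (\max_(a : medge G) \max_(s < d) absz (mtau a 0%R s))%N.
have aD (a : medge G) (s : 'I_d) : (absz (mtau a 0%R s) <= D)%N.
  apply: leq_trans (leq_bigmax a).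
  exact: (@leq_bigmax _ (fun s => absz (mtau a 0%R s)) s).
exists D => c s; rewrite /ctau; elim: c => [|a c IH]; first by rewrite big_nil mxE.
rewrite big_cons mxE /= mulSn; have := aD a s; clearbody D.
move: IH; move: (size c * D)%N.
by move: ((\sum_(a <- c) mtau a)%R 0%R s) (mtau a 0%R s) => x y E; lia.
Qed.

Lemma uniform_eigenvalue_bound (L : R) : 0 < L ->
  (forall k i, `|fiber_eigenvalue V k i| < L) ->
  exists r, [/\ 0 <= r, r < L &
    forall t, box t -> forall i, `|fiber_eigenvalue V (kvec t) i| <= r].
Proof.
move=> L0 eL.
have half24 : 1 / 2 <= 1 - 2 * 4^-1 :> R by lra.
pose K : set 'rV[R]_d := [set v | forall i, `[0, 2 * pi]%classic (v ord0 i)].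
have cK : compact K by apply: (@rV_compact R d (fun=> `[0, 2 * pi]%classic)) => i; exact: segment_compact.
pose q k n := \sum_i (fiber_eigenvalue V k i / L) ^+ (2 * n).
have qE k n : q k n = trace_pow V (2 * n) k / L ^+ (2 * n).
  by rewrite trace_powE mulr_suml; apply: eq_bigr => i _; rewrite exprMn exprVn.
have qmono k n p : (n <= p)%N -> q k p <= q k n.
  move=> np; apply: ler_sum => i _; rewrite !exprM.
  apply: ler_wiXn2l; rewrite ?sqr_ge0 //.
  rewrite -real_normK ?num_real // exprn_ile1 // normrM normfV (gtr0_norm L0).
  by rewrite ler_pdivrMr // mul1r ltW.
have eL1 k i : `|fiber_eigenvalue V k i / L| < 1.
  by rewrite normrM normfV (gtr0_norm L0) ltr_pdivrMr // mul1r.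
have q0 k : q k n @[n --> \oo] --> (0 : R).
  apply: cvg_seq_sum0 => i.
  rewrite (_ : (fun n => _) = (fun n => 1 * ((fiber_eigenvalue V k i / L) ^+ 2) ^+ n)).
    apply: geometric_cvg0; rewrite sqr_ge0 -real_normK ?num_real //.
    by rewrite /= expr_lt1 // eL1.
  by apply/funext => n; rewrite mul1r exprM.
have [n0 _ Hn] : \forall n \near \oo, K `<=` (fun k => q k n < 1 / 2).
  apply: ((compact_near_coveringP K).1 cK) => // k _.
  have [n1 _ Hn1] : \forall n \near \oo, q k n < 1 / 2.
    have /cvgrPdist_lt/(_ (1 / 2)) := q0 k; rewrite divr_gt0 // => /(_ isT).
    by apply: filterS => n; rewrite sub0r normrN; apply: le_lt_trans; exact: ler_norm.
  exists ([set x | q x n1 < 1 / 2], [set p | (n1 <= p)%N]) => /=.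
    split; last by exists n1.
    have cq : {for k, continuous (fun x => q x n1)}.
      rewrite (_ : (fun x => _) = (fun x => trace_pow V (2 * n1) x / L ^+ (2 * n1))); last first.
        by apply/funext => x; rewrite qE.
      by apply: continuousM; [exact: continuous_trace_pow|exact: cst_continuous].
    have := Hn1 n1 (leqnn _) => qk.
    have /cvgrPdist_lt/(_ (1 / 2 - q k n1)) := cq; rewrite subr_gt0 => /(_ qk).
    apply: filterS => x /=; rewrite distrC => /(le_lt_trans (ler_norm _)).
    by rewrite ltrD2r.
  by move=> [x p] /= [qx np]; exact: le_lt_trans (qmono _ _ _ np) qx.
pose n := maxn 1 n0; have n1 : (0 < n)%N by rewrite leq_max.
have {Hn}Hn : K `<=` (fun k => q k n < 1 / 2) by apply: Hn; rewrite /= leq_maxr.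
pose x : R := (4 * n)%:R^-1.
have x01 : 0 <= x <= 1.
  by rewrite invr_ge0 ler0n invf_le1 ?ltr0n ?muln_gt0 // ler1n muln_gt0.
have x0 : 0 < x by rewrite invr_gt0 ltr0n muln_gt0.
have half : 1 / 2 <= (1 - x) ^+ (2 * n).
  apply: le_trans (bernoulli_ge (2 * n) x01).
  rewrite /x !natrM invfM mulrACA mulfV ?mulr1 ?pnatr_eq0 -?lt0n //.
exists (L * (1 - x)); split.
- by rewrite mulr_ge0 ?(ltW L0) // subr_ge0; case/andP: x01.
- by rewrite gtr_pMr // ltrBlDr ltrDl.
move=> t bt i.
have Kt : K (kvec t).
  by move=> j /=; rewrite mxE in_itv /=; case/andP: (bt j) => -> /ltW ->.
rewrite mulrC -ler_pdivrMr // -(gtr0_norm L0) -normfV -normrM.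
rewrite -(@ler_pXn2r _ (2 * n)) ?nnegrE ?muln_gt0 ?normr_ge0 ?subr_ge0 //; last by case/andP: x01.
apply: le_trans half; apply: le_trans (ltW (Hn _ Kt)).
rewrite -normrX ger0_norm; last by rewrite exprM exprn_ge0 // sqr_ge0.
rewrite /q (bigD1 i) //= lerDl sumr_ge0 // => j _.
by rewrite exprM exprn_ge0 // sqr_ge0.
Qed.

End fourier.

Lemma int_box_fset (d N : nat) : exists B : {fset 'rV[int]_d},
  (forall m : 'rV[int]_d, (forall s, (absz (m 0%R s) <= N)%N) -> m \in B) /\
  (#|` B| <= (2 * N).+1 ^ d)%N.
Proof.
pose f (p : {ffun 'I_d -> 'I_(2 * N).+1}) : 'rV[int]_d := \row_s ((p s : nat)%:Z - N%:Z).
exists [fset f p | p in {: {ffun 'I_d -> 'I_(2 * N).+1}}]%fset; split=> [m mN|].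
  have ltm s : (absz (m 0%R s + N%:Z)%R < (2 * N).+1)%N by have := mN s; lia.
  apply/imfsetP; exists [ffun s => Ordinal (ltm s)] => //=.
  by apply/rowP => s; rewrite mxE ffunE /=; have := mN s; lia.
apply: leq_trans (leq_imfset_card _ _ _) _.
by rewrite -cardE card_ffun !card_ord.
Qed.

Section cycle_sums.
Variables (R : realType) (d : nat) (G : periodic_graph R d) (V : vert G -> R).
Notation nu := #|qvert G|.
Notation box := (@torus_box R d).

Lemma by_length_res_term (P : pred (seq (medge G))) l n :
  by_length P (res_term V l) n =
  toC (\sum_(c : n.-tuple (medge G) | is_cycle c && P c) weight V c) / l ^+ n.+1.
Proof.
rewrite /by_length [toC _]rmorph_sum mulr_suml; apply: eq_bigr => c _.
by rewrite /res_term size_tuple.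
Qed.

Lemma sum_Tnm_cos n k (B : {fset 'rV[int]_d}) :
  (forall c : n.-tuple (medge G), ctau c \in B) ->
  \sum_(m <- B) Tnm V n m * cos (pairing m k) = Tn V n k.
Proof.
move=> cB; rewrite /Tn /Tnm.
under eq_bigr do rewrite mulr_suml.
rewrite (exchange_big_dep (fun c : n.-tuple (medge G) => is_cycle c)) /=; last first.
  by move=> m c _ /andP[].
apply: eq_bigr => c cc; rewrite -big_filter.
rewrite (eq_filter (a2 := pred1 (ctau c))); last first.
  by move=> m /=; rewrite cc eq_sym.
by rewrite (filter_pred1_uniq (fset_uniq B) (cB c)) big_seq1.
Qed.

Lemma Tnm_eq0 n m (B : {fset 'rV[int]_d}) :
  (forall c : n.-tuple (medge G), ctau c \in B) -> m \notin B -> Tnm V n m = 0.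
Proof.
move=> cB mB; rewrite /Tnm big_pred0 // => c; apply: contraNF mB => /andP[_ /eqP <-].
exact: cB.
Qed.

Lemma fourier_expansion (l : Cx R) (r : R) : 0 <= r -> r < cabs l ->
  (forall t, box t -> forall i, `|fiber_eigenvalue V (kvec t) i| <= r) ->
  (forall m : 'rV[int]_d,
     abs_cvg1 (by_length (fun c : seq (medge G) => ctau c == m) (res_term V l))) /\
  (forall k, let tm (m : 'rV[int]_d) := Rm V m l * toC (cos (pairing m k)) in
     abs_summable tm /\ csum tm = csum1 (fun n => toC (Tn V n k) / l ^+ n.+1)).
Proof.
move=> r0 rl br.
have l0 : 0 < cabs l by exact: le_lt_trans rl.
have q01 : 0 <= r / cabs l < 1 by rewrite divr_ge0 ?(ltW l0) //= ltr_pdivrMr // mul1r.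
have abR m : abs_cvg1 (by_length (fun c : seq (medge G) => ctau c == m) (res_term V l)).
  apply: (@eq_abs_cvg1 _ (fun n => toC (Tnm V n m) / l ^+ n.+1)) => [n _|].
    by rewrite by_length_res_term.
  apply: (abs_cvg1_le_geometric (G := G) r0 rl) => n n0.
  exact: (ler_norm_Tnm m n0 br).
split=> // k tm.
have [D HD] := ctau_bound G.
pose Bn n := projT1 (cid (int_box_fset d (n * D))).
have inB n (c : n.-tuple (medge G)) : ctau c \in Bn n.
  have [H _] := projT2 (cid (int_box_fset d (n * D))); apply: H => s.
  by have := HD c s; rewrite size_tuple.
have cardB n : (#|` Bn n| <= (2 * (n * D)).+1 ^ d)%N.
  by have [_ ] := projT2 (cid (int_box_fset d (n * D))).
pose a n m : Cx R := toC (Tnm V n m) / l ^+ n.+1 * toC (cos (pairing m k)).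
have [C [s [C0 s01 Cs]]] := @polynomial_geometric_bound R (2 * D)%:R d _ (ler0n _ _) q01.
pose b n : R := nu%:R / cabs l * C * s ^+ n.
have a0 n m : (0 < n)%N -> m \notin Bn n -> a n m = 0.
  by move=> n0 mB; rewrite /a (Tnm_eq0 (inB n) mB) rmorph0 !mul0r.
have ab n : (0 < n)%N -> \sum_(m <- Bn n) cabs (a n m) <= b n.
  move=> n0; apply: (@le_trans _ _ (\sum_(m <- Bn n) (nu%:R / cabs l * (r / cabs l) ^+ n))).
    apply: ler_sum => m _; rewrite /a cabsM cabsM !cabs_toC cabsV cabsX.
    apply: (@le_trans _ _ (nu%:R * r ^+ n / cabs l ^+ n.+1 * 1)).
      apply: ler_pM => //; last by rewrite ler_norml cos_geN1 cos_le1.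
        by rewrite divr_ge0 // exprn_ge0 // cabs_ge0.
      by rewrite ler_wpM2r ?invr_ge0 ?exprn_ge0 ?cabs_ge0 // (ler_norm_Tnm m n0 br).
    rewrite mulr1 exprS invfM exprMn exprVn le_eqVlt; apply/orP; left; apply/eqP; ring.
  rewrite big_const_seq count_predT iter_addr addr0 -[_ *+ size _]mulr_natr.
  rewrite /b -!mulrA !ler_wpM2l ?invr_ge0 ?cabs_ge0 // mulrC.
  apply: le_trans (Cs n); rewrite ler_wpM2r ?exprn_ge0 //; first by case/andP: q01.
  apply: (@le_trans _ _ (((2 * (n * D)).+1 ^ d)%:R)); first by rewrite ler_nat.
  by rewrite natrX -natr1 mulnCA mulnC natrM.
have cb : cvgn (fun N => \sum_(1 <= n < N) b n) by exact: cvg_sum1_geometric.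
have tmE : tm = fun m => csum1 (a ^~ m).
  apply/funext => m; symmetry; apply: csum1_eq.
  have := @cvg_cabsMl _ (toC (cos (pairing m k))) _ _ (abs_cvg1_cvg (abR m)).
  rewrite mulrC -/(Rm V m l) -/(tm m) (_ : (fun N => _) = (fun N => \sum_(1 <= n < N) a n m)) //.
  apply/funext => N; rewrite mulr_sumr; apply: eq_bigr => n _.
  by rewrite by_length_res_term mulrC.
split; first by rewrite tmE; exact: (double_series_summable a0 ab cb).
rewrite tmE; have [_ ->] := double_series_sum a0 ab cb.
apply: eq_csum1 => n n0; rewrite -(sum_Tnm_cos k (inB n)) toC_sum mulr_suml.
by apply: eq_bigr => m _; rewrite /a rmorphM mulrAC.
Qed.

Lemma torus_mean_cvg (l : Cx R) (r : R) : 0 <= r -> r < cabs l ->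
  (forall k i, `|fiber_eigenvalue V k i| <= r) ->
  toC ((2 * pi) ^- d) * torus_int (fun k : 'rV[R]_d => tr_resolvent (fiber V k) l) =
  - (nu%:R / l) - csum1 (fun n => toC (Tnm V n 0) / l ^+ n.+1).
Proof.
move=> r0 rl br; have mB := @measurable_torus_box R d.
pose c n : Cx R := - (l ^+ n.+1)^-1.
pose F N (k : 'rV[R]_d) := \sum_(0 <= n < N) c n * toC (trace_pow V n k).
have mRe n : measurable_fun box (fun t => complex.Re (F n (kvec t) : R[i])).
  apply: measurable_funTS.
  rewrite (_ : (fun t => _) = (fun t => \sum_(i <- index_iota 0 n)
    complex.Re (c i : R[i]) * trace_pow V i (kvec t))).
    apply: measurable_sum => i; apply: measurable_funM; first exact: measurable_cst.
    exact: measurable_trace_pow.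
  apply/funext => t; rewrite Re_sum; apply: eq_bigr => i _.
  by rewrite mulrC Re_toCM mulrC.
have mIm n : measurable_fun box (fun t => complex.Im (F n (kvec t) : R[i])).
  apply: measurable_funTS.
  rewrite (_ : (fun t => _) = (fun t => \sum_(i <- index_iota 0 n)
    complex.Im (c i : R[i]) * trace_pow V i (kvec t))).
    apply: measurable_sum => i; apply: measurable_funM; first exact: measurable_cst.
    exact: measurable_trace_pow.
  apply/funext => t; rewrite Im_sum; apply: eq_bigr => i _.
  by rewrite mulrC Im_toCM mulrC.
have FB n k : cabs (F n k) <= 2 * (nu%:R / (cabs l - r)).
  exact: (resolvent_series_bound r0 rl (br k)).
have Fc k : F n k @[n --> \oo] --> tr_resolvent (fiber V k) l.
  exact: (resolvent_series_cvg r0 rl (br k)).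
have H := @cvg_cabsMl _ (toC ((2 * pi) ^- d)) _ _ (cvg_torus_int mRe mIm FB Fc).
pose T0 n : R := if n is 0 then nu%:R else Tnm V n 0.
have ip n : (lebesgue_tuple R d).-integrable box (EFin \o (trace_pow V n \o @kvec R d)).
  apply: (@integrable_torus_bounded _ _ _ (nu%:R * r ^+ n)) => [|t _].
    by apply: measurable_funTS; exact: measurable_trace_pow.
  exact: ler_norm_trace_pow.
have p0 : (2 * pi) ^+ d != 0 :> R by rewrite expf_neq0 // mulf_neq0 // gt_eqF // pi_gt0.
have FE : (fun N => toC ((2 * pi) ^- d) * torus_int (F N)) =
    (fun N => \sum_(0 <= n < N) c n * toC (T0 n)).
  apply/funext => N; rewrite torus_int_sum // mulr_sumr; apply: eq_bigr => n _.
  rewrite Rintegral_trace_pow -/(T0 n) [toC (_ * _)]rmorphM mulrCA; congr (_ * _).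
  by rewrite mulrA -[_ * toC ((2 * pi) ^+ d)]rmorphM /= mulVf // rmorph1 mul1r.
rewrite FE in H.
rewrite (csum1_of_series (u := fun n => toC (Tnm V n 0) / l ^+ n.+1) _ H) => [|n n0].
  by rewrite /c /T0 rmorph_nat expr1; ring.
by case: n n0 => // n _; rewrite /c /= mulNr mulrC.
Qed.

End cycle_sums.

Theorem corollary2p8 (R : realType) (d : nat) (G : periodic_graph R d)
    (V : vert G -> R) (hV : periodic_potential V) :
  (* (1) *)
  (forall (k : 'rV[R]_d) (lambda : Cx R),
    (opnorm (fiber V k) < (cabs lambda)%:E)%E ->
    let tn (n : nat) := toC (Tn V n k) / lambda ^+ n.+1 in
    let te := by_length xpredT (fun c : seq (medge G) =>
      res_term V lambda c * expi (- pairing (ctau c) k)) in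
    let tc := by_length xpredT (fun c : seq (medge G) =>
      res_term V lambda c * toC (cos (pairing (ctau c) k))) in
    [/\ opmx (fiber V k) - lambda%:M \in unitmx,
        [/\ abs_cvg1 tn, abs_cvg1 te & abs_cvg1 tc],
        tr_resolvent (fiber V k) lambda = - (#|qvert G|%:R / lambda) - csum1 tn,
        tr_resolvent (fiber V k) lambda = - (#|qvert G|%:R / lambda) - csum1 te
      & tr_resolvent (fiber V k) lambda = - (#|qvert G|%:R / lambda) - csum1 tc])
  /\
  (* (2) *)
  (forall lambda : Cx R,
    (forall k : 'rV[R]_d, (opnorm (fiber V k) < (cabs lambda)%:E)%E) ->
    (forall m : 'rV[int]_d,
      abs_cvg1 (by_length (fun c : seq (medge G) => ctau c == m)
                          (res_term V lambda))) /\
    (forall k : 'rV[R]_d,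
      let tm (m : 'rV[int]_d) := Rm V m lambda * toC (cos (pairing m k)) in
      abs_summable tm /\
      tr_resolvent (fiber V k) lambda = - (#|qvert G|%:R / lambda) - csum tm))
  /\
  (* (3) *)
  (forall lambda : Cx R,
    (opnorm (schroedinger V) < (cabs lambda)%:E)%E ->
    let tn (n : nat) := toC (Tnm V n 0) / lambda ^+ n.+1 in
    let tc := by_length (fun c : seq (medge G) => ctau c == 0)
                        (res_term V lambda) in
    let mean := toC ((2 * pi) ^- d) *
      torus_int (fun k : 'rV[R]_d => tr_resolvent (fiber V k) lambda) in
    [/\ forall k : 'rV[R]_d, opmx (fiber V k) - lambda%:M \in unitmx,
        abs_cvg1 tn /\ abs_cvg1 tc,
        mean = - (#|qvert G|%:R / lambda) - csum1 tn
      & mean = - (#|qvert G|%:R / lambda) - csum1 tc]).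
Proof.
split; [|split].
- move=> k l Hl tn te tc.
  have l0 : 0 < cabs l by rewrite -lte_fin; exact: le_lt_trans (opnorm_ge0 _) Hl.
  have [r [r0 rl Tr]] := opnorm_lt_ex Hl l0.
  have br i := fiber_eigenvalue_le_opnorm i r0 Tr.
  have [ab E] := resolvent_expansion r0 rl br.
  have tcE n : tn n = tc n.
    rewrite /tc /tn /by_length /Tn [toC _]rmorph_sum mulr_suml.
    apply: eq_big => [c|c _]; first by rewrite andbT.
    by rewrite /res_term size_tuple rmorphM mulrAC.
  have teE n : (0 < n)%N -> tn n = te n.
    move=> n0; rewrite tcE -[LHS]subr0.
    have := congr1 (fun x => 'i * (toC x / l ^+ n.+1)) (sum_cycles_sin V k n0).
    rewrite rmorph0 mul0r mulr0 => <-.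
    rewrite [toC _]rmorph_sum mulr_suml mulr_sumr.
    rewrite (eq_bigl (fun c : n.-tuple (medge G) => is_cycle c && true)) => [|c]; last by rewrite andbT.
    rewrite -sumrB; apply: eq_bigr => c _.
    by rewrite expi_cos_sin cosN sinN rmorphN rmorphM /res_term size_tuple; ring.
  split=> //; first exact: (fiber_resolvent_unit rl br).
  + split=> //; first exact: eq_abs_cvg1 teE ab.
    by apply: eq_abs_cvg1 ab => n _; exact: tcE.
  + by rewrite -(eq_csum1 teE).
  by rewrite -(@eq_csum1 _ tn) // => n _; exact: tcE.
- move=> l Hl.
  have l0 : 0 < cabs l by rewrite -lte_fin; exact: le_lt_trans (opnorm_ge0 _) (Hl 0).
  have el k i : `|fiber_eigenvalue V k i| < cabs l.
    have [r [r0 rl Tr]] := opnorm_lt_ex (Hl k) l0.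
    exact: le_lt_trans (fiber_eigenvalue_le_opnorm i r0 Tr) rl.
  have [r [r0 rl br]] := uniform_eigenvalue_bound l0 el.
  have [abR Ek] := fourier_expansion r0 rl br.
  split=> // k tm; have [sm ->] := Ek k; split=> //.
  have [r' [r'0 r'l Tr]] := opnorm_lt_ex (Hl k) l0.
  have br' i := fiber_eigenvalue_le_opnorm i r'0 Tr.
  by have [_] := resolvent_expansion r'0 r'l br'.
move=> l Hl tn tc mean.
have l0 : 0 < cabs l by rewrite -lte_fin; exact: le_lt_trans (opnorm_ge0 _) Hl.
have [r [r0 rl Tr]] := opnorm_lt_ex Hl l0.
have br k i := fiber_eigenvalue_le_schroedinger k i hV r0 Tr.
have tnE n : tn n = tc n by rewrite /tc by_length_res_term.
have ab : abs_cvg1 tn.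
  apply: (abs_cvg1_le_geometric (G := G) r0 rl) => n n0.
  by apply: ler_norm_Tnm n0 _ => t _; exact: br.
have E : mean = - (#|qvert G|%:R / l) - csum1 tn by exact: (torus_mean_cvg r0 rl br).
split=> // [k||].
- exact: (fiber_resolvent_unit rl (br k)).
- by split=> //; apply: eq_abs_cvg1 ab => n _; exact: tnE.
by rewrite -(@eq_csum1 _ tn) // => n _; exact: tnE.
Qed.
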